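(* There exists a minimal, uniquely ergodic $4$-IET with exactly four flips. In particular, $\mathcal{I}(4,4)\neq\emptyset$ and $\mathcal{C}(3,3)\neq\emptyset$.
   Context: An $n$-IET of $[0,\ell]$ is given by a partition $0=a_0<a_1<\dots<a_n=\ell$, $I_i=(a_{i-1},a_i)$, and an injective map $T:\bigcup I_i\to[0,\ell]$ which is an isometry on each $I_i$ and cannot be continuously extended to a larger open set. Similarly an $n$-CET is defined on $S^1=[0,1]/(0\sim1)$ with $n$ pairwise disjoint open subintervals whose closures cover $S^1$ and the same conditions. A flip is a subinterval on which $T$ reverses orientation. The orbit of $p$ is $\{T^m(p):m\in\mathbb{Z},\ p\in\mathrm{Dom}(T^m)\}$; $T$ is transitive if some orbit is dense, and minimal if it is transitive and has no finite orbits (points outside $\mathrm{Dom}(T)\cup\mathrm{Dom}(T^{-1})$ count as having finite orbit $\{p\}$). $T$ is uniquely ergodic if Lebesgue measure is, up to scalar multiple, the only $T$-invariant Borel measure. $\mathcal{I}(n,f)$ (resp. $\mathcal{C}(n,f)$) denotes the set of transitive IETs (resp. CETs) of $n$ subintervals with exactly $f$ flips.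
   Formalization: ''No finite orbits'' is required only of points of the open interval (0,ℓ), since the endpoints 0 and ℓ always have finite orbit; unique ergodicity is among finite invariant Borel measures, since counting measure on an infinite orbit is also invariant. *)

(* Defs.v *)
From HB Require Import structures.
From mathcomp Require Import all_boot all_order all_algebra.
From mathcomp Require Import all_classical all_reals all_analysis.
From mathcomp Require Import Rstruct Rstruct_topology.
Import Order.TTheory GRing.Theory Num.Theory numFieldNormedType.Exports.

Set Implicit Arguments.
Unset Strict Implicit.
Unset Printing Implicit Defensive.

Local Open Scope classical_set_scope.
Local Open Scope ring_scope.

Notation RR := Rdefinitions.R.

Section Defs.
Context {R : realType}.
Implicit Types (x y l : R).

(* Partially defined dynamics: T is only defined on the set D.         *)
Inductive fwd (D : set R) (T : R -> R) : nat -> R -> R -> Prop :=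
| fwd0 x : fwd D T 0 x x
| fwdS m x y : D x -> fwd D T m (T x) y -> fwd D T m.+1 x y.

(* The orbit {T^m p : m in Z, p in Dom(T^m)}; for m < 0, T^m p = q
   iff q in Dom(T^|m|) and T^|m| q = p (T is injective). *)
Definition orbit (D : set R) (T : R -> R) (p : R) : set R :=
  [set q | exists m, fwd D T m p q \/ fwd D T m q p].

(* a 0 = 0 < a 1 < ... < a n = l, I_i = ]a_(i-1), a_i[ (here indexed   *)
(* from 0: I_i = ]a i, a (i+1)[ for i < n).                            *)

Definition IET_dom (n : nat) (a : nat -> R) : set R :=
  [set x | exists2 i, (i < n)%N & a i < x < a i.+1].

Definition is_IET (n : nat) (l : R) (a : nat -> R) (T : R -> R) : Prop :=
  [/\ [/\ (0 < n)%N, a 0%N = 0, a n = l &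
      (forall i, (i < n)%N -> a i < a i.+1)],
      (forall x y, IET_dom n a x -> IET_dom n a y -> T x = T y -> x = y),
      (forall x, IET_dom n a x -> 0 <= T x <= l),
      (forall i x y, (i < n)%N -> a i < x < a i.+1 -> a i < y < a i.+1 ->
          `|T x - T y| = `|x - y|) &
      ~ (exists (U : set R) (g : R -> R),
           [/\ open U, IET_dom n a `<` U, U `<=` `[0, l],
               {within U, continuous g} &
               (forall x, IET_dom n a x -> g x = T x)])].

Definition IET_flip (a : nat -> R) (T : R -> R) (i : nat) : Prop :=
  forall x y, a i < x -> x < y -> y < a i.+1 -> T y < T x.

Definition IET_nflips (n : nat) (a : nat -> R) (T : R -> R) (f : nat) : Prop :=
  exists S : {set 'I_n}, #|S| = f /\ (forall i : 'I_n, i \in S <-> IET_flip a T i).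

Definition IET_transitive (n : nat) (l : R) (a : nat -> R) (T : R -> R) : Prop :=
  exists p, `[0, l] `<=` closure (orbit (IET_dom n a) T p).

Definition IET_minimal (n : nat) (l : R) (a : nat -> R) (T : R -> R) : Prop :=
  IET_transitive n l a T /\
  (forall p, 0 < p < l -> ~ finite_set (orbit (IET_dom n a) T p)).

(* Finite Borel measures on [0, l] are represented as finite Borel
   measures on R giving no mass to the complement of [0, l]. *)
Definition IET_invariant (n : nat) (l : R) (a : nat -> R) (T : R -> R)
    (mu : set R -> \bar R) : Prop :=
  forall A : set R, measurable A -> mu (IET_dom n a `&` T @^-1` A) = mu A.

Definition IET_uniquely_ergodic (n : nat) (l : R) (a : nat -> R) (T : R -> R) : Prop :=
  IET_invariant n l a T (fun A => lebesgue_measure (A `&` `[0, l])) /\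
  (forall mu : {measure set R -> \bar R},
     (mu setT < +oo)%E -> mu (~` `[0, l]) = 0%E ->
     IET_invariant n l a T mu ->
     exists c : R, 0 <= c /\
       forall A : set R, measurable A ->
         mu A = (c%:E * lebesgue_measure (A `&` `[0%R, l]))%E).

Definition calI (n f : nat) : set (R * (nat -> R) * (R -> R)) :=
  [set lat | let: (l, a, T) := lat in
     [/\ is_IET n l a T, IET_nflips n a T f & IET_transitive n l a T]].

(* Circle exchange transformations: S^1 = [0,1]/(0~1) is represented   *)
(* by the points of [0,1[, with the quotient distance.                 *)

Definition cfrac (x : R) : R := x - (Num.floor x)%:~R.

Definition cdist (x y : R) : R := Num.min `|x - y| (1 - `|x - y|).

(* cut points 0 <= c 0 < c 1 < ... < c (n-1) < 1; the n open arcs are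
   ]c i, c (i+1)[ for i < n-1 and the arc from c (n-1) through 0 to c 0 *)
Definition CET_arc (n : nat) (c : nat -> R) (i : nat) : set R :=
  if (i.+1 < n)%N then [set x | c i < x < c i.+1]
  else [set x | (c i < x < 1) \/ (0 <= x < c 0%N)].

Definition CET_dom (n : nat) (c : nat -> R) : set R :=
  [set x | 0 <= x < 1 /\ forall i, (i < n)%N -> x <> c i].

Definition circle_open (U : set R) : Prop :=
  forall x, U x -> exists2 d : R, 0 < d &
    forall y, 0 <= y < 1 -> cdist x y < d -> U y.

Definition circle_continuous_on (U : set R) (g : R -> R) : Prop :=
  forall x, U x -> forall e : R, 0 < e -> exists2 d : R, 0 < d &
    forall y, U y -> cdist x y < d -> cdist (g x) (g y) < e.

Definition is_CET (n : nat) (c : nat -> R) (T : R -> R) : Prop :=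
  [/\ [/\ (0 < n)%N, 0 <= c 0%N, c n.-1 < 1 &
      (forall i, (i.+1 < n)%N -> c i < c i.+1)],
      (forall x y, CET_dom n c x -> CET_dom n c y -> T x = T y -> x = y),
      (forall x, CET_dom n c x -> 0 <= T x < 1),
      (forall i x y, (i < n)%N -> CET_arc n c i x -> CET_arc n c i y ->
          cdist (T x) (T y) = cdist x y) &
      ~ (exists (U : set R) (g : R -> R),
           [/\ [/\ circle_open U, U `<=` [set x | 0 <= x < 1] &
               CET_dom n c `<` U],
               (forall x, U x -> 0 <= g x < 1),
               circle_continuous_on U g &
               (forall x, CET_dom n c x -> g x = T x)])].

(* T reverses orientation on the i-th arc: it is there a reflection
   x |-> t - x (mod 1) of the circle *)
Definition CET_flip (n : nat) (c : nat -> R) (T : R -> R) (i : nat) : Prop :=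
  exists t : R, forall x, CET_arc n c i x -> T x = cfrac (t - x).

Definition CET_nflips (n : nat) (c : nat -> R) (T : R -> R) (f : nat) : Prop :=
  exists S : {set 'I_n}, #|S| = f /\ (forall i : 'I_n, i \in S <-> CET_flip n c T i).

Definition CET_transitive (n : nat) (c : nat -> R) (T : R -> R) : Prop :=
  exists p, forall x, 0 <= x < 1 -> forall e : R, 0 < e ->
    exists q, orbit (CET_dom n c) T p q /\ 0 <= q < 1 /\ cdist q x < e.

Definition calC (n f : nat) : set ((nat -> R) * (R -> R)) :=
  [set cT | let: (c, T) := cT in
     [/\ is_CET n c T, CET_nflips n c T f & CET_transitive n c T]].

End Defs.

(* Main.v *)
(* Let b + b^2 + b^3 = 1. The interval exchange [trib] flips each of the four cells
   bounded by 0, b/2, 1/2, 1 - b^2/2, 1 and is self-similar: its first-return map to the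
   image of ]0,1[ under x |-> (b - b^2)/2 + b^2 x is conjugate to it by that contraction,
   and the towers over the four image cells have 5, 1, 3 and 5 floors.
   - Every orbit in ]0,1[ enters the image of ]0,1[, hence, by iteration, every floor of
     the iterated towers: every orbit is dense, in particular infinite.
   - An invariant finite measure has no atoms since orbits are infinite, so its
     distribution function G is monotone and its increments change sign under the flips.
     This class is stable under composition with the contraction, and the vector of
     increments over the cells is multiplied by the tower matrix. One column of that
     matrix is positive, so the projective action contracts and the increments are
     proportional to the lengths of the cells. Hence the deviation of G from an affine
     function is bounded by that of its renormalizations, which tends to 0.
   - On the circle the first and last cells form a single arc on which [trib] is one
     reflection; this gives the circle exchange. *)
Require Import Defs.
From HB Require Import structures.
From mathcomp Require Import all_boot all_order all_algebra.
From mathcomp Require Import all_classical all_reals all_analysis.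
From mathcomp Require Import Rstruct Rstruct_topology.
From mathcomp Require Import measurable_realfun ring lra.
(* [fingraph] also has an [orbit]. *)
Import Defs.
Import Order.TTheory GRing.Theory Num.Theory numFieldNormedType.Exports.
Local Open Scope classical_set_scope.
Local Open Scope ring_scope.

(** * Orbit equivalence for a partially defined injective map *)

Section Orbits.
Context {R : realType} (D : set R) (T : R -> R).

Lemma fwd_trans {m n x y z} : fwd D T m x y -> fwd D T n y z -> fwd D T (m + n) x z.
Proof. by elim=> [//|k u v Du _ IH] /IH; rewrite addSn => /(fwdS Du). Qed.

Lemma fwd_rcons m x z : fwd D T m.+1 x z ->
  exists y, [/\ fwd D T m x y, D y & T y = z].
Proof.
elim: m x => [|m IH] x H; inversion H; subst.
  by inversion H2; subst; exists x; split => //; exact: fwd0.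
have [y [xy Dy yz]] := IH _ H2.
by exists y; split => //; exact: fwdS.
Qed.

Lemma orbit_refl p : orbit D T p p.
Proof. by exists 0%N; left; exact: fwd0. Qed.

Lemma orbit_sym p q : orbit D T p q -> orbit D T q p.
Proof. by case=> m [?|?]; exists m; [right|left]. Qed.

Lemma orbit_step p : D p -> orbit D T p (T p).
Proof. by move=> Dp; exists 1%N; left; apply: fwdS => //; exact: fwd0. Qed.

Lemma fwd_det m n p q r : fwd D T m p q -> fwd D T n p r -> orbit D T q r.
Proof.
move=> H; elim: H n r => {m p q} [p|m p q Dp pq IH] n r pr.
  by exists n; left.
inversion pr as [|k ? ? Dp' pr']; subst; last exact: IH pr'.
by exists m.+1; right; exact: fwdS.
Qed.

Hypothesis T_inj : forall x y, D x -> D y -> T x = T y -> x = y.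

(** Injectivity lets two paths with a common end be cancelled from their last step backwards. *)
Lemma fwd_codet m n p q r : fwd D T m q p -> fwd D T n r p -> orbit D T q r.
Proof.
elim: m n p => [|m IH] n p.
  by move=> H; inversion H; subst => rp; exists n; right.
case: n => [|n] qp rp.
  by inversion rp; subst; exists m.+1; left.
have [y [qy Dy yp]] := fwd_rcons _ _ _ qp.
have [y' [ry Dy' yp']] := fwd_rcons _ _ _ rp.
have yy : y = y' by apply: T_inj => //; rewrite yp.
by subst y'; exact: IH qy ry.
Qed.

Lemma orbit_trans p q r : orbit D T p q -> orbit D T q r -> orbit D T p r.
Proof.
move=> [m [pq|qp]] [n [qr|rq]].
- by exists (m + n)%N; left; exact: fwd_trans pq qr.
- exact: fwd_codet pq rq.
- exact: fwd_det qp qr.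
- by exists (n + m)%N; right; exact: fwd_trans rq qp.
Qed.

End Orbits.

(** * Locating points, small powers and distances on the circle *)

Lemma orbit_sub {R : realType} (D D' : set R) (T : R -> R) p q :
  D `<=` D' -> orbit D T p q -> orbit D' T p q.
Proof.
move=> sub.
have fwd_sub m x y : fwd D T m x y -> fwd D' T m x y.
  by elim=> [z|k u v Du _ IH]; [exact: fwd0|apply: fwdS => //; exact: sub].
by case=> m [/fwd_sub|/fwd_sub] H; exists m; [left|right].
Qed.

(** Descending from [e], the first index met with [f m <= x] works. It locates points among [cut],
    [brk] and [im] without sorting them first. *)
Lemma step_cover {R : realType} (f : nat -> R) s e x : (s < e)%N -> f s <= x <= f e ->
  exists m, (s <= m < e)%N /\ f m <= x <= f m.+1.
Proof.
elim: e => [//|e IH] se /andP[h1 h2].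
have [le|lt] := lerP (f e) x.
  by exists e; rewrite -ltnS se ltnS leqnn le h2.
have {}se : (s < e)%N.
  by rewrite ltn_neqAle -ltnS se andbT; apply/eqP => E; move: h1; rewrite E leNgt lt.
have [m [/andP[sm me] xm]] := IH se ltac:(by rewrite h1 ltW).
by exists m; rewrite sm ltnS (ltnW me).
Qed.

Lemma exprn_small {R : realType} (z e : R) : 0 <= z < 1 -> 0 < e -> exists k, z ^+ k < e.
Proof.
move=> /andP[z0 z1] e0.
have /cvgrPdist_lt/(_ _ e0)[k _ H] : z ^+ n @[n --> \oo] --> (0 : R).
  by apply: cvg_expr; rewrite ger0_norm.
exists k; have := H k (leqnn k).
by rewrite sub0r normrN ger0_norm // exprn_ge0.
Qed.

Lemma cdist_le {R : realType} (x y : R) : cdist x y <= `|x - y|.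
Proof. by rewrite /cdist ge_min lexx. Qed.

(** Triangle inequality: [u] and [v] would be at circle distance below 1/10, while the last bound
    puts it above 3/20. *)
Lemma cdist_near {R : realType} (u v w : R) : 0 <= u < 1 -> 0 <= v < 1 -> 0 <= w < 1 ->
  cdist w u < 1 / 20 -> cdist w v < 1 / 20 -> 3 / 20 < `|u - v| < 17 / 20 -> False.
Proof.
rewrite /cdist !gt_min.
case: (ger0P (w - u)) => ?; case: (ger0P (w - v)) => ?; case: (ger0P (u - v)) => ?;
  by move=> /andP[? ?] /andP[? ?] /andP[? ?] /orP[?|?] /orP[?|?] /andP[? ?]; lra.
Qed.

Lemma cfracD {R : realType} (x : R) (k : int) : 0 <= x + k%:~R < 1 -> cfrac x = x + k%:~R.
Proof.
move=> /andP[h1 h2]; rewrite /cfrac (floor_def (m := - k)) ?mulrNz ?opprK //.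
by rewrite intrD mulrNz; apply/andP; split; lra.
Qed.

Lemma cdist_sym {R : realType} (x y : R) : cdist x y = cdist y x.
Proof. by rewrite /cdist distrC. Qed.

(** * Lebesgue measure under reflections; equal atoms *)

Section Measures.
Context {R : realType}.

Lemma lebesgue_measure_reflect (t : R) (A : set R) : measurable A ->
  lebesgue_measure ((fun x => t - x) @^-1` A) = lebesgue_measure A.
Proof.
move=> mA.
have mf : measurable_fun setT (fun x : R => t - x : measurableTypeR R).
  by apply: measurable_funB; [exact: measurable_cst|exact: measurable_id].
change (pushforward lebesgue_measure (fun x : R => t - x : measurableTypeR R) A = lebesgue_measure A).
apply/esym/lebesgue_measure_unique => //= _ [[a c]] _ <-.
rewrite /pushforward.
have -> : (fun x : R => t - x) @^-1` `]a, c]%classic = `[t - c, t - a[%classic.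
  by apply/seteqP; split => x /=; rewrite !in_itv /= => /andP[? ?]; apply/andP; split; lra.
rewrite /= !lebesgue_measure_itv /= !lte_fin ltrD2l ltrN2; case: ifP => // _.
by rewrite -!EFinB; congr EFin; ring.
Qed.

(** Any [n] points of [A] have total mass [n] times that of [x], which the finite total mass bounds
    for all [n]. *)
Lemma atom_infinite (mu : {measure set R -> \bar R}) (A : set R) x :
  (mu setT < +oo)%E -> infinite_set A -> (forall y, A y -> mu [set y] = mu [set x]) ->
  mu [set x] = 0%E.
Proof.
move=> fin /infiniteP/ppcard_leP[f] Ax.
apply/eqP/negPn/negP => n0.
have fA n : A (f n) by exact: 'funS_f.
have fI m n : f m = f n -> m = n by move=> e; apply: 'inj_f e; rewrite inE.
have xfin : mu [set x] \is a fin_num.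
  rewrite ge0_fin_numE //; apply: le_lt_trans fin; apply: le_measure; rewrite ?inE //.
have r0 : 0 < fine (mu [set x]).
  by rewrite lt_neqAle fine_ge0 // andbT eq_sym fine_eq0.
have Mfin : mu setT \is a fin_num by rewrite ge0_fin_numE.
have bound n : n%:R * fine (mu [set x]) <= fine (mu setT).
  rewrite -lee_fin fineK // mulr_natl.
  have -> : (fine (mu [set x]) *+ n)%:E = mu (\big[setU/set0]_(i < n) [set f i]).
    rewrite measure_bigsetU_ord; last 2 first.
    - by move=> i; exact: measurable_set1.
    - by move=> k l _ _ [y [/= -> /= /fI/val_inj]].
    rewrite (eq_bigr (fun=> (fine (mu [set x]))%:E)); last first.
      by move=> k _; rewrite fineK //; exact: Ax.
    by rewrite sumEFin sumr_const card_ord.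
  apply: le_measure; rewrite ?inE //.
  by apply: bigsetU_measurable => k _; exact: measurable_set1.
have := bound (Num.truncn (fine (mu setT) / fine (mu [set x]))).+1.
by rewrite -ler_pdivlMr // leNgt truncnS_gt.
Qed.

End Measures.

(** * The flipped interval exchange and its towers *)

Section Tribonacci.
Context {R : realType} (b : R).
Hypothesis b_gt0 : 0 < b.
Hypothesis b_trib : b + b ^+ 2 + b ^+ 3 = 1.

(* [cut i = 1] for all [i >= 4]. *)
Definition cut (i : nat) : R := nth 1 [:: 0; b / 2; 1 / 2; 1 - b ^+ 2 / 2] i.

(** The constant value of [x + trib x] on a cell. Since [mirror 3 = mirror 0 + 1], the two end cells
    carry the same reflection modulo 1. *)
Definition mirror (i : nat) : R :=
  nth 0 [:: (1 + b - b ^+ 2) / 2; 1 + b / 2; 1 - b ^+ 2 / 2; (3 + b - b ^+ 2) / 2] i.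

Definition trib (x : R) : R :=
  if x < cut 1 then mirror 0 - x else
  if x < cut 2 then mirror 1 - x else
  if x < cut 3 then mirror 2 - x else mirror 3 - x.

Definition contr (x : R) : R := (b - b ^+ 2) / 2 + b ^+ 2 * x.

(* [word i] is the itinerary of [contr x], for [x] in the [i]-th cell, until its
   first return to [contr @` `]0, 1[]. *)
Definition word (i : nat) : seq nat :=
  nth [::] [:: [:: 0; 1; 2; 0; 2]; [:: 0]; [:: 1; 3; 2]; [:: 1; 3; 2; 0; 2]]%N i.

(** Endpoints, in increasing order, of the 5 + 1 + 3 + 5 = 14 tower floors; the default value
    supplies the last one, [brk 14 = 1]. *)
Definition brk (m : nat) : R :=
  nth 1 [:: 0; (1 - b - b ^+ 2) / 2; (b - b ^+ 2) / 2; 1 / 2 - b ^+ 2; b / 2;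
    (1 - b + b ^+ 2) / 2; (b + b ^+ 2) / 2; 1 / 2; b; (1 + b - b ^+ 2) / 2;
    1 - b / 2; (1 + b) / 2; 1 - b ^+ 2 / 2; 1 / 2 + b - b ^+ 2 / 2] m.

(* [lev m = (i, j)]: the [m]-th interval [`]brk m, brk m.+1[] is the [j]-th floor of the
   Rokhlin tower over the image by [contr] of the [i]-th cell. *)
Definition lev (m : nat) : nat * nat :=
  nth (0, 0)%N [:: (0, 3); (3, 3); (0, 0); (1, 0); (2, 0); (3, 0); (0, 1); (3, 4);
    (0, 4); (2, 2); (3, 2); (0, 2); (3, 1); (2, 1)]%N m.

Definition base m := (lev m).1.
Definition pre m := take (lev m).2 (word (base m)).
Definition letter m := nth 0%N (word (base m)) (lev m).2.

(** * Arithmetic in powers of [b] *)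

Lemma b_bounds : 27 / 50 < b < 11 / 20.
Proof.
have mono (x y : R) : 0 <= x -> x <= y -> x + x ^+ 2 + x ^+ 3 <= y + y ^+ 2 + y ^+ 3.
  move=> x0 xy; have y0 := le_trans x0 xy.
  by rewrite !lerD // lerXn2r // nnegrE.
(* The increasing polynomial x + x^2 + x^3 is below 1 at 27/50 and above 1 at 11/20. *)
apply/andP; split; rewrite ltNge; apply/negP => h.
  by have := mono _ _ (ltW b_gt0) h; rewrite b_trib; lra.
by have := mono _ _ _ h; rewrite b_trib => /(_ ltac:(lra)); lra.
Qed.

(** With [b4], this reduces powers of [b] to combinations of 1, [b] and [b ^+ 2], which [lra] can
    treat as independent. *)
Lemma b3 : b ^+ 3 = 1 - b - b ^+ 2. Proof. move: b_trib; lra. Qed.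
Lemma b4 : b ^+ 4 = 2 * b - 1.
Proof. by have h := b3; rewrite exprS h !mulrBr -exprS h; lra. Qed.
Lemma b2_bounds : 29 / 100 < b ^+ 2 < 31 / 100.
Proof.
have /andP[lo hi] := b_bounds; apply/andP; split.
  by have := sqr_ge0 (b - 27 / 50); rewrite sqrrB; lra.
have : 0 < b * (11 / 20 - b) by rewrite mulr_gt0 // subr_gt0.
by rewrite mulrBr -expr2; lra.
Qed.

(** * Itineraries and self-similarity *)

Fixpoint follows (r : rel R) (w : seq nat) (x : R) : bool :=
  if w is k :: w' then [&& r (cut k) x, r x (cut k.+1) & follows r w' (mirror k - x)]
  else true.

Definition travel (w : seq nat) (x : R) : R := foldl (fun y k => mirror k - y) x w.

Lemma follows_cat r w w' x :
  follows r (w ++ w') x = follows r w x && follows r w' (travel w x).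
Proof. by elim: w x => [//|k w IH] x /=; rewrite IH !andbA. Qed.

Lemma cut_lt i : (i < 4)%N -> cut i < cut i.+1.
Proof.
have := b_bounds; have := b2_bounds.
by case: i => [|[|[|[|//]]]] /andP[? ?] /andP[? ?] _; rewrite /cut /=; lra.
Qed.

Lemma contr_bounds i x : cut i <= x <= cut i.+1 ->
  b ^+ 2 * cut i <= b ^+ 2 * x <= b ^+ 2 * cut i.+1.
Proof.
move=> /andP[h1 h2]; have b20 : 0 <= b ^+ 2 by apply: sqr_ge0.
by rewrite !ler_wpM2l.
Qed.

(** The weak version, valid at the ends of cells, serves the functional equations; the strict one
    below serves true orbits. *)
Lemma word_le i x : (i < 4)%N -> cut i <= x <= cut i.+1 ->
  follows <=%R (word i) (contr x).
Proof.
move=> i4 /contr_bounds; have := b_bounds; have := b2_bounds.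
have := b3; have := b4.
case: i i4 => [|[|[|[|//]]]] _ h4 h3 /andP[? ?] /andP[? ?] /andP[];
 (* With [b ^+ 2 * x] as a single unknown [y], all inequalities become linear. *)
 rewrite /contr /=; set y := b ^+ 2 * x; rewrite /cut /mirror /=; clearbody y => *;
 repeat (apply/andP; split); lra.
Qed.

Lemma word_lt i x : (i < 4)%N -> cut i < x < cut i.+1 ->
  follows <%R (word i) (contr x).
Proof.
move=> i4 /andP[h1 h2]; have b20 : 0 < b ^+ 2 by apply: exprn_gt0.
have : b ^+ 2 * cut i < b ^+ 2 * x < b ^+ 2 * cut i.+1 by rewrite !ltr_pM2l // h1.
clear h1 h2 b20.
have := b_bounds; have := b2_bounds; have := b3; have := b4.
case: i i4 => [|[|[|[|//]]]] _ h4 h3 /andP[? ?] /andP[? ?] /andP[];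
 rewrite /contr /=; set y := b ^+ 2 * x; rewrite /cut /mirror /=; clearbody y => *;
 repeat (apply/andP; split); lra.
Qed.

(** Self-similarity: every word has odd length, so the return is again a reflection, and the
    relations for [b ^+ 3] and [b ^+ 4] identify its constant. *)
Lemma travel_word i x : (i < 4)%N -> travel (word i) (contr x) = contr (mirror i - x).
Proof.
have := b3; have := b4.
case: i => [|[|[|[|//]]]] h4 h3 _; rewrite /travel /contr /= /mirror /=; lra.
Qed.

(** Every letter reflects, so the parity of the height decides which end of the floor receives the
    left end of the base cell. *)
Lemma travel_pre m x : (m < 14)%N -> travel (pre m) (contr x) =
  if odd (size (pre m)) then brk m.+1 - b ^+ 2 * (x - cut (base m))
  else brk m + b ^+ 2 * (x - cut (base m)).
Proof.
have := b3; have := b4 => h4 h3.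
do 14 (case: m => [_|m] ; first by rewrite /travel /contr /= /mirror /brk /cut /=; lra).
by [].
Qed.

Lemma brk_diff m : (m < 14)%N ->
  brk m.+1 - brk m = b ^+ 2 * (cut (base m).+1 - cut (base m)).
Proof.
have := b3; have := b4 => h4 h3.
do 14 (case: m => [_|m] ; first by rewrite /brk /cut /=; lra).
by [].
Qed.

Lemma lev_ok m : (m < 14)%N -> [/\ (base m < 4)%N, (letter m < 4)%N &
  word (base m) = pre m ++ letter m :: drop (lev m).2.+1 (word (base m))].
Proof. by do 14 (case: m => [//|m]). Qed.

Lemma follows_lev (r : rel R) m x : (m < 14)%N -> follows r (word (base m)) x ->
  follows r (pre m) x /\ r (cut (letter m)) (travel (pre m) x) /\
  r (travel (pre m) x) (cut (letter m).+1).
Proof.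
move=> m14; have [_ _ ->] := lev_ok m m14.
by rewrite follows_cat /= => /and4P[].
Qed.

Lemma cut_strict k x : cut k < x < cut k.+1 -> (k < 4)%N.
Proof.
case: k => [|[|[|[|k]]]] // /andP[h1 h2]; have := lt_trans h1 h2.
by rewrite /cut /= !nth_default // ltxx.
Qed.

Lemma trib_cell i x : cut i < x < cut i.+1 -> trib x = mirror i - x.
Proof.
move=> xi; have i4 := cut_strict _ _ xi; move: xi.
have c0 := cut_lt 0 isT; have c1 := cut_lt 1 isT; have c2 := cut_lt 2 isT.
rewrite /trib; case: i i4 => [|[|[|[|//]]]] _ /andP[h1 h2].
- by rewrite h2.
- by rewrite h2 (lt_gtF h1).
- by rewrite h2 (lt_gtF h1) (lt_gtF (lt_trans c1 h1)).
- by rewrite (lt_gtF h1) (lt_gtF (lt_trans c2 h1)) (lt_gtF (lt_trans c1 (lt_trans c2 h1))).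
Qed.

(** * Renormalization of orbits *)

Local Notation dom := (IET_dom 4 cut).
Local Notation orb := (orbit dom trib).

Lemma dom_cell i x : cut i < x < cut i.+1 -> dom x.
Proof. by move=> xi; exists i => //; exact: cut_strict xi. Qed.

Lemma mirror_bounds i x : cut i < x < cut i.+1 -> 0 < mirror i - x < 1.
Proof.
move=> xi; have i4 := cut_strict _ _ xi; move: xi.
have := b_bounds; have := b2_bounds.
case: i i4 => [|[|[|[|//]]]] _ /andP[? ?] /andP[? ?];
  rewrite /cut /mirror /= => /andP[? ?]; apply/andP; split; lra.
Qed.

Lemma trib_inj x y : dom x -> dom y -> trib x = trib y -> x = y.
Proof.
move=> [i i4 xi] [j j4 yj]; rewrite (trib_cell _ _ xi) (trib_cell _ _ yj).
have := b_bounds; have := b2_bounds; move: xi yj.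
case: i i4 => [|[|[|[|//]]]] _; case: j j4 => [|[|[|[|//]]]] _;
  rewrite /cut /mirror /= => /andP[? ?] /andP[? ?] /andP[? ?] /andP[? ?]; lra.
Qed.

Lemma orb_trans p q r : orb p q -> orb q r -> orb p r.
Proof. by apply: orbit_trans => x y; exact: trib_inj. Qed.

Lemma orb_follows w x : follows <%R w x -> orb x (travel w x).
Proof.
elim: w x => [|k w IH] x /=; first by move=> _; exact: orbit_refl.
case/and3P=> h1 h2 /IH; apply: orb_trans.
have xk : cut k < x < cut k.+1 by rewrite h1.
by rewrite -(trib_cell _ _ xk); apply: orbit_step; exact: dom_cell xk.
Qed.

(** A single step from cell [i], once contracted, becomes the whole passage along [word i]. *)
Lemma orb_contr p q : orb p q -> orb (contr p) (contr q).
Proof.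
have step m x y : fwd dom trib m x y -> orb (contr x) (contr y).
  elim=> [z|k u v [i i4 ui] _]; first exact: orbit_refl.
  apply: orb_trans; rewrite (trib_cell _ _ ui) -(travel_word _ _ i4).
  by apply: orb_follows; exact: word_lt.
by case=> m [/step //|/step]; exact: orbit_sym.
Qed.

(** Inverts the affine map of [travel_pre]: every point of a floor descends to the base cell of its
    tower. *)
Lemma lev_inv m x : (m < 14)%N -> brk m <= x <= brk m.+1 ->
  exists y, [/\ cut (base m) <= y <= cut (base m).+1, travel (pre m) (contr y) = x &
    brk m < x < brk m.+1 -> cut (base m) < y < cut (base m).+1].
Proof.
move=> m14 /andP[h1 h2]; have d := brk_diff _ m14.
have b20 : 0 < b ^+ 2 by exact: exprn_gt0.
(* The offset is measured from the end of the floor that receives the left end of the base cell. *)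
exists (cut (base m) + (if odd (size (pre m)) then brk m.+1 - x else x - brk m) / b ^+ 2).
have key z : z / b ^+ 2 * b ^+ 2 = z by rewrite mulfVK // gt_eqF.
set z := (if _ then _ else _).
have z0 : 0 <= z by rewrite /z; case: ifP => _; rewrite subr_ge0.
have z1 : z <= b ^+ 2 * (cut (base m).+1 - cut (base m)).
  by rewrite -d /z; case: ifP => _; lra.
split.
- rewrite lerDl divr_ge0 //= ?(ltW b20) // addrC -lerBrDr ler_pdivrMr //.
  by rewrite mulrC.
- rewrite travel_pre //.
  have -> : b ^+ 2 * (cut (base m) + z / b ^+ 2 - cut (base m)) = z.
    by rewrite addrC addKr mulrC key.
  by rewrite /z; case: (odd _); lra.
- move=> /andP[h3 h4]; have z0' : 0 < z by rewrite /z; case: ifP => _; rewrite subr_gt0.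
  have z1' : z < b ^+ 2 * (cut (base m).+1 - cut (base m)).
    by rewrite -d /z; case: ifP => _; lra.
  by rewrite ltrDl divr_gt0 //= addrC -ltrBrDr ltr_pdivrMr // mulrC.
Qed.

Lemma contr_onto z : contr 0 < z < contr 1 -> exists2 y, 0 < y < 1 & contr y = z.
Proof.
have b20 : 0 < b ^+ 2 by exact: exprn_gt0.
rewrite /contr mulr0 mulr1 addr0 => /andP[h1 h2].
exists ((z - (b - b ^+ 2) / 2) / b ^+ 2).
  by rewrite divr_gt0 ?subr_gt0 //= ltr_pdivrMr // mul1r ltrBlDr addrC.
by rewrite [b ^+ 2 * _]mulrC mulfVK ?gt_eqF // addrC subrK.
Qed.

Local Ltac numeric := rewrite /travel /= /contr /brk /mirror /cut /=;
  repeat (apply/andP; split); lra.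

(** Breakpoints lie on no open floor and need explicit paths. Some lead forward into the image of
    ]0, 1[; a breakpoint whose forward orbit stops first at a cut point is reached from [brk 3] or
    [brk 5] instead. *)
Lemma brk_meets m : (0 < m < 14)%N ->
  exists2 z, contr 0 < z < contr 1 & orb (brk m) z.
Proof.
have := b_bounds; have := b2_bounds; have h3 := b3.
move=> /andP[? ?] /andP[? ?].
have in3 : contr 0 < brk 3 < contr 1 by numeric.
have in5 : contr 0 < brk 5 < contr 1 by numeric.
have fwdP w k : follows <%R w (brk k) -> contr 0 < travel w (brk k) < contr 1 ->
    exists2 z, contr 0 < z < contr 1 & orb (brk k) z.
  by move=> fw tw; exists (travel w (brk k)) => //; exact: orb_follows.
have bwdP w k l : follows <%R w (brk k) -> contr 0 < brk k < contr 1 ->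
    travel w (brk k) = brk l -> exists2 z, contr 0 < z < contr 1 & orb (brk l) z.
  move=> fw kin e; exists (brk k) => //; apply: orbit_sym; rewrite -e.
  exact: orb_follows.
case: m => [|[|[|[|[|[|[|[|[|[|[|[|[|[|m]]]]]]]]]]]]]] // _.
- by apply: (fwdP [:: 0; 2]%N); numeric.
- by apply: (bwdP [:: 1; 3; 2]%N 5%N); [numeric|exact: in5|numeric].
- by apply: (fwdP [::]%N); numeric.
- by apply: (fwdP [::]%N); numeric.
- by apply: (fwdP [::]%N); numeric.
- by apply: (bwdP [:: 0]%N 3%N); [numeric|exact: in3|numeric].
- by apply: (bwdP [:: 1; 3; 2; 0]%N 5%N); [numeric|exact: in5|numeric].
- by apply: (fwdP [:: 2]%N); numeric.
- by apply: (fwdP [:: 2]%N); numeric.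
- by apply: (bwdP [:: 1; 3]%N 5%N); [numeric|exact: in5|numeric].
- by apply: (fwdP [:: 2; 0; 2]%N); numeric.
- by apply: (bwdP [:: 0; 1]%N 3%N); [numeric|exact: in3|numeric].
- by apply: (bwdP [:: 1]%N 5%N); [numeric|exact: in5|numeric].
Qed.

(** A point inside a floor descends its tower; the floors cover ]0, 1[ up to breakpoints. *)
Lemma orb_meets_contr p : 0 < p < 1 -> exists2 q, 0 < q < 1 & orb p (contr q).
Proof.
move=> /andP[p0 p1].
have [|m [/andP[_ m14] pm]] := step_cover brk 0 14 p isT.
  by rewrite /brk /= !ltW.
have via z : contr 0 < z < contr 1 -> orb p z -> exists2 q, 0 < q < 1 & orb p (contr q).
  by move=> /contr_onto[y y01 <-] pz; exists y.
have /andP[pm1 pm2] := pm.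
case: (boolP (brk m == p)) => [/eqP e|ne1].
  have [|z zin] := brk_meets m.
    by rewrite m14 lt0n andbT; apply/eqP => m0; move: p0; rewrite -e m0 /brk /= ltxx.
  by rewrite e => /(via _ zin).
case: (boolP (p == brk m.+1)) => [/eqP e|ne2].
  have [|z zin] := brk_meets m.+1; last by rewrite -e => /(via _ zin).
  rewrite /= ltnS ltn_neqAle -ltnS m14 andbT; apply/eqP => m13.
  by move: p1; rewrite e m13 /brk /= ltxx.
have [y [yi ty yst]] := lev_inv _ _ m14 pm.
have {}yst : cut (base m) < y < cut (base m).+1.
  by apply: yst; rewrite !lt_neqAle ne1 ne2 pm1.
have [b4' _ _] := lev_ok _ m14.
have [fo _] := follows_lev _ _ _ m14 (word_lt _ _ b4' yst).
exists y; last by apply: orbit_sym; rewrite -ty; exact: orb_follows.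
move: b4' yst {yi fo}; have := b_bounds; have := b2_bounds.
case: (base m) => [|[|[|[|//]]]] /andP[? ?] /andP[? ?] _;
  rewrite /cut /= => /andP[? ?]; apply/andP; split; lra.
Qed.

(** * Density of orbits *)

Definition meets (p : R) (j : nat) := exists2 q, orb p q & cut j < q < cut j.+1.

Lemma meets_lift p p' j k : orb p (contr p') -> meets p' j -> k \in word j -> meets p k.
Proof.
move=> pp' [q p'q qj] kj; have j4 := cut_strict _ _ qj.
have := word_lt _ _ j4 qj.
have [w [w' ->]] : exists w w', word j = w ++ k :: w'.
  by case/splitPr: kj => w w'; exists w, w'.
rewrite follows_cat => /andP[fo] /= /and3P[h1 h2 _].
exists (travel w (contr q)); last by rewrite h1.
apply: orb_trans pp' (orb_trans _ _ _ (orb_contr _ _ p'q) _).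
exact: orb_follows.
Qed.

(** A cut point lies in no open cell, so a preimage is used: the images of cells 2, 0, 1 contain
    [cut 1], [cut 2], [cut 3] respectively. *)
Lemma meets_cut i : (0 < i < 4)%N -> exists2 j, (j < 4)%N & meets (cut i) j.
Proof.
have := b_bounds; have := b2_bounds => /andP[? ?] /andP[? ?].
have back j : (j < 4)%N -> cut j < mirror j - cut i < cut j.+1 ->
    exists2 j, (j < 4)%N & meets (cut i) j.
  move=> j4 xj; exists j => //; exists (mirror j - cut i) => //.
  apply: orbit_sym; rewrite -[X in orb _ X](subKr (mirror j)) -(trib_cell _ _ xj).
  by apply: orbit_step; exact: dom_cell xj.
case: i back => [|[|[|[|i]]]] // back _; [apply: (back 2)|apply: (back 0)|apply: (back 1)];
  rewrite // /cut /mirror /=; apply/andP; split; lra.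
Qed.

Lemma meets_some p : 0 < p < 1 -> exists2 j, (j < 4)%N & meets p j.
Proof.
move=> /andP[p0 p1].
have [|m [/andP[_ m4] /andP[h1 h2]]] := step_cover cut 0 4 p isT.
  by rewrite /cut /= !ltW.
have := h1; rewrite le_eqVlt => /predU1P[e|lt1].
  rewrite -e; apply: meets_cut; rewrite m4 lt0n andbT.
  by apply/eqP => m0; move: p0; rewrite -e m0 /cut /= ltxx.
have := h2; rewrite le_eqVlt => /predU1P[e|lt2].
  rewrite e; apply: meets_cut; rewrite /= ltn_neqAle m4 andbT.
  by apply/eqP => m3; move: p1; rewrite e m3 /cut /= ltxx.
by exists m => //; exists p; [exact: orbit_refl|rewrite lt1].
Qed.

(** Primitivity of the substitution [word]: successive renormalizations force a letter among 0, 2,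
    3, then the letter 2, then 3, and [word 3] contains every letter. *)
Lemma meets_all p j : 0 < p < 1 -> (j < 4)%N -> meets p j.
Proof.
have step2 q : 0 < q < 1 -> exists2 j, meets q j & j \in [:: 0; 2; 3]%N.
  move=> /orb_meets_contr[q' /meets_some[i i4 qi] qq'].
  case: i i4 qi => [|[|[|[|//]]]] _ qi; [exists 0%N|exists 0%N|exists 2%N|exists 3%N] => //;
    exact: meets_lift qq' qi _.
have all2 q : 0 < q < 1 -> meets q 2.
  move=> /orb_meets_contr[q' /step2[i qi i3] qq'].
  apply: (meets_lift _ _ _ _ qq' qi).
  by move: i3; rewrite !inE => /or3P[] /eqP ->.
have all3 q : 0 < q < 1 -> meets q 3.
  by move=> /orb_meets_contr[q' /all2 qi qq']; exact: meets_lift qq' qi _.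
move=> /orb_meets_contr[q' /all3 qi qq'] j4.
apply: (meets_lift _ _ _ _ qq' qi).
by case: j j4 => [|[|[|[|]]]].
Qed.

(** Up to endpoints, cell [i] is the union of the floors from [blk i] up to, but excluding,
    [blk i.+1]. *)
Definition blk (i : nat) := nth 14%N [:: 0; 4; 7; 12]%N i.

Lemma brk_blk i : (i <= 4)%N -> brk (blk i) = cut i.
Proof. by case: i => [|[|[|[|[|]]]]]. Qed.

Lemma letter_blk i m : (i < 4)%N -> (blk i <= m < blk i.+1)%N ->
  (m < 14)%N /\ letter m = i.
Proof.
by case: i => [|[|[|[|//]]]] _; do 14 (case: m => [//|m]).
Qed.

(** The target [y] descends to [z] in a base cell, the renormalized orbit approaches [z] by
    induction, and climbing back multiplies the error by [b ^+ 2]. *)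
Lemma meets_near k p i y : 0 < p < 1 -> (i < 4)%N -> cut i <= y <= cut i.+1 ->
  exists q, [/\ orb p q, cut i < q < cut i.+1 & `|q - y| <= (b ^+ 2) ^+ k].
Proof.
have b20 : 0 < b ^+ 2 by exact: exprn_gt0.
elim: k p i y => [|k IH] p i y p01 i4 yi.
  have [q pq qi] := meets_all _ _ p01 i4; exists q; split => //.
  rewrite expr0; have := b_bounds; have := b2_bounds; move: qi yi; rewrite ler_norml.
  by case: i i4 => [|[|[|[|//]]]] _; rewrite /cut /=;
    move=> /andP[? ?] /andP[? ?] /andP[? ?] /andP[? ?]; apply/andP; split; lra.
have blk_lt : (blk i < blk i.+1)%N by case: i i4 {yi} => [|[|[|[|//]]]].
have yb : brk (blk i) <= y <= brk (blk i.+1) by rewrite !brk_blk // ltnW.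
have [m [mi ym]] := step_cover _ _ _ _ blk_lt yb.
have [m14 lm] := letter_blk _ _ i4 mi.
have [j4 _ _] := lev_ok _ m14.
have [z [zj yz _]] := lev_inv _ _ m14 ym.
have [p' p'01 pp'] := orb_meets_contr _ p01.
have [q [p'q qj qz]] := IH p' _ z p'01 j4 zj.
have [fo [h1 h2]] := follows_lev _ _ _ m14 (word_lt _ _ j4 qj).
exists (travel (pre m) (contr q)); split.
- apply: orb_trans pp' (orb_trans _ _ _ (orb_contr _ _ p'q) _).
  exact: orb_follows.
- by rewrite -lm h1.
- rewrite -yz !travel_pre // [_ ^+ k.+1]exprS; case: (odd _).
    rewrite (_ : _ - _ = - (b ^+ 2 * (q - z))); last by ring.
    by rewrite normrN normrM gtr0_norm // ler_pM2l.
  rewrite (_ : _ - _ = b ^+ 2 * (q - z)); last by ring.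
  by rewrite normrM gtr0_norm // ler_pM2l.
Qed.

Lemma orb_dense p x e : 0 < p < 1 -> 0 <= x <= 1 -> 0 < e ->
  exists q, [/\ orb p q, 0 < q < 1 & `|q - x| < e].
Proof.
move=> p01 x01 e0.
have [k ke] : exists k, (b ^+ 2) ^+ k < e.
  apply: exprn_small => //; rewrite sqr_ge0 /=.
  by case/andP: b2_bounds => ? ?; lra.
have [|i [/andP[_ i4] xi]] := step_cover cut 0 4 x isT.
  by rewrite /cut /=.
have [q [pq qi qx]] := meets_near k _ _ _ p01 i4 xi.
exists q; split => //; last exact: le_lt_trans qx ke.
move: qi; have := b_bounds; have := b2_bounds.
by case: i i4 {xi} => [|[|[|[|//]]]] _ /andP[? ?] /andP[? ?];
  rewrite /cut /= => /andP[? ?]; apply/andP; split; lra.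
Qed.

(** The part of a finite orbit in ]0, 1[ would be closed, yet by density 0 is a limit of its
    points. *)
Lemma orb_infinite p : 0 < p < 1 -> infinite_set (orb p).
Proof.
move=> p01 fin; set A := orb p `&` [set q | 0 < q < 1].
have clA : closed A.
  have/accessible_finite_set_closed := hausdorff_accessible (@Rhausdorff R).
  by apply; exact: finite_setIl.
have [|_ /=] := clA 0; last by rewrite ltxx.
move=> B /nbhs_ballP[e /= e0 eB].
have [|q [pq q01 qe]] := orb_dense p 0 e p01 _ e0; first by rewrite lexx ler01.
by exists q; split => //; apply: eB; rewrite /ball /= distrC.
Qed.

(** * Functions whose increments change sign under flips *)

Definition flip_eq (G : R -> R) := forall i x y, (i < 4)%N ->
  cut i <= x <= cut i.+1 -> cut i <= y <= cut i.+1 ->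
  G (mirror i - x) - G (mirror i - y) = - (G x - G y).

Lemma flip_eq_travel G w x y : flip_eq G ->
  follows <=%R w x -> follows <=%R w y ->
  G (travel w x) - G (travel w y) = (-1) ^+ size w * (G x - G y).
Proof.
move=> fG; elim: w x y => [|k w IH] x y /=; first by rewrite mul1r.
move=> /and3P[x1 x2 fx] /and3P[y1 y2 fy]; rewrite IH // exprS.
case: (ltnP k 4) => k4; first by rewrite (fG k) ?x1 ?y1 //; ring.
(* For a letter beyond 3 the closed cell is the single point 1, so both differences vanish. *)
have ck j : (4 <= j)%N -> cut j = 1 by move=> ?; rewrite /cut nth_default.
have one z : cut k <= z -> z <= cut k.+1 -> z = 1.
  rewrite !ck ?(leqW k4) // => ? ?; exact: le_anti (introT andP (conj _ _)).
by rewrite (one x) // (one y) //; ring.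
Qed.

(** All words have odd length, so the signs of their letters multiply to -1. *)
Lemma flip_eq_contr G : flip_eq G -> flip_eq (G \o contr).
Proof.
move=> fG i x y i4 xi yi /=.
rewrite -!travel_word // flip_eq_travel //; try exact: word_le.
have -> : (-1) ^+ size (word i) = -1 :> R.
  by case: i i4 {xi yi} => [|[|[|[|//]]]] _; rewrite /= -signr_odd.
by rewrite mulN1r.
Qed.

Lemma flip_eq_lev G m x y : flip_eq G -> (m < 14)%N ->
  cut (base m) <= x <= cut (base m).+1 -> cut (base m) <= y <= cut (base m).+1 ->
  G (travel (pre m) (contr x)) - G (travel (pre m) (contr y)) =
  (-1) ^+ size (pre m) * (G (contr x) - G (contr y)).
Proof.
move=> fG m14 xi yi; have [i4 _ _] := lev_ok _ m14.
have [fx _] := follows_lev _ _ _ m14 (word_le _ _ i4 xi).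
have [fy _] := follows_lev _ _ _ m14 (word_le _ _ i4 yi).
exact: flip_eq_travel.
Qed.

(** * The tower matrix and its contraction *)

Definition len i := cut i.+1 - cut i.
Definition incr (G : R -> R) i := G (cut i.+1) - G (cut i).

(** On a floor of odd height the sign change and the exchange of endpoints compensate each other. *)
Lemma incr_lev G m : flip_eq G -> (m < 14)%N ->
  G (brk m.+1) - G (brk m) = incr (G \o contr) (base m).
Proof.
move=> fG m14; have [i4 _ _] := lev_ok _ m14; have ci := cut_lt _ i4.
have := flip_eq_lev G m (cut (base m).+1) (cut (base m)) fG m14.
rewrite !lexx (ltW ci) !travel_pre // -brk_diff // subrr mulr0 -signr_odd.
rewrite /incr /=; move=> /(_ isT isT); case: (odd _) => /=.
  by rewrite subr0 subKr expr1; lra.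
by rewrite addr0 subrKC expr0 mul1r.
Qed.

(** Each cell is a union of floors; the coefficients count them by tower. *)
Lemma incr_contr G (v := incr (G \o contr)) : flip_eq G ->
  [/\ incr G 0%N = 2 * v 0%N + v 1%N + v 3%N, incr G 1%N = v 0%N + v 2%N + v 3%N,
      incr G 2%N = 2 * v 0%N + v 2%N + 2 * v 3%N & incr G 3%N = v 2%N + v 3%N].
Proof.
move=> fG; rewrite /incr.
rewrite -[cut 0%N]/(brk 0%N) -[cut 1%N]/(brk 4%N) -[cut 2%N]/(brk 7%N) -[cut 3%N]/(brk 12%N) -[cut 4%N]/(brk 14%N).
have e m : (m < 14)%N -> G (brk m.+1) = G (brk m) + v (base m).
  by move=> m14; have := incr_lev G m fG m14; rewrite -/v; lra.
rewrite !e //= /base /=; split; ring.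
Qed.

(** The lengths form the right Perron-Frobenius eigenvector of the tower matrix, for the eigenvalue
    inverse to [b ^+ 2]. *)
Lemma len_eigen :
  [/\ b ^+ 2 * (2 * len 0%N + len 1%N + len 3%N) = len 0%N, b ^+ 2 * (len 0%N + len 2%N + len 3%N) = len 1%N,
      b ^+ 2 * (2 * len 0%N + len 2%N + 2 * len 3%N) = len 2%N & b ^+ 2 * (len 2%N + len 3%N) = len 3%N].
Proof.
have := b3; have := b4 => h4 h3.
by rewrite /len /cut /=; split; lra.
Qed.

Lemma cut01 i : 0 <= cut i <= 1.
Proof.
have := b_bounds; have := b2_bounds => /andP[? ?] /andP[? ?].
case: i => [|[|[|[|i]]]]; rewrite /cut /= ?nth_default ?lexx ?ler01 //;
  apply/andP; split; lra.
Qed.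

Lemma len_bounds : [/\ 1 / 4 < len 0%N <= b ^+ 2, 1 / 5 < len 1%N <= b ^+ 2,
  1 / 3 < len 2%N <= 2 * b ^+ 2 & 1 / 7 < len 3%N <= b ^+ 2].
Proof.
have := b_bounds; have := b2_bounds => /andP[? ?] /andP[? ?].
by rewrite /len /cut /=; split; apply/andP; split; lra.
Qed.

Lemma len01 i : (i < 4)%N -> 0 <= len i <= 1.
Proof.
move=> i4; have /andP[c0 _] := cut01 i; have /andP[_ c1] := cut01 i.+1.
by rewrite subr_ge0 (ltW (cut_lt _ i4)) /len; lra.
Qed.

(** Doeblin minorization: [b ^+ 2] times the last column of the tower matrix dominates the length
    vector, and the other columns contribute nonnegatively. *)
Lemma doeblin_col (w : nat -> R) : (forall j, (j < 4)%N -> 0 <= w j) ->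
  [/\ w 3%N * len 0%N <= b ^+ 2 * (2 * w 0%N + w 1%N + w 3%N),
      w 3%N * len 1%N <= b ^+ 2 * (w 0%N + w 2%N + w 3%N),
      w 3%N * len 2%N <= b ^+ 2 * (2 * w 0%N + w 2%N + 2 * w 3%N) &
      w 3%N * len 3%N <= b ^+ 2 * (w 2%N + w 3%N)].
Proof.
move=> w0; have [/andP[_ ?] /andP[_ ?] /andP[_ ?] /andP[_ ?]] := len_bounds.
have col x y : x <= y -> w 3%N * x <= w 3%N * y by apply: ler_wpM2l; exact: w0.
have bw j : (j < 4)%N -> 0 <= b ^+ 2 * w j by move=> j4; rewrite mulr_ge0 ?sqr_ge0 ?w0.
have := bw 0%N isT; have := bw 1%N isT; have := bw 2%N isT.
split; [move: (col (len 0%N) (b ^+ 2)) | move: (col (len 1%N) (b ^+ 2))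
  | move: (col (len 2%N) (2 * b ^+ 2)) | move: (col (len 3%N) (b ^+ 2))] => /(_ ltac:(by [])); lra.
Qed.

(** The minorization applies to the nonnegative gaps between the increments and their two bounds. As
    the lengths are an eigenvector, both bounds move inwards. *)
Lemma doeblin G p q : flip_eq G ->
  (forall i, (i < 4)%N -> p * len i <= incr (G \o contr) i <= q * len i) ->
  exists p' q', q' - p' = (q - p) * (1 - len 3%N) /\
    forall i, (i < 4)%N -> p' * len i <= b ^+ 2 * incr G i <= q' * len i.
Proof.
move=> /incr_contr; set v := incr (G \o contr) => -[e0 e1 e2 e3] pq.
have [l0 l1 l2 l3] := len_eigen.
exists (p + (v 3%N - p * len 3%N)), (q - (q * len 3%N - v 3%N)); split; first by ring.
have [|p0 p1 p2 p3] := doeblin_col (fun j => v j - p * len j).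
  by move=> j /pq /andP[h _]; rewrite subr_ge0.
have [|q0 q1 q2 q3] := doeblin_col (fun j => q * len j - v j).
  by move=> j /pq /andP[_ h]; rewrite subr_ge0.
have lp (c x y : R) : x = y -> c * x = c * y by move=> ->.
case=> [|[|[|[|//]]]] _; apply/andP.
- by rewrite e0; have := lp p _ _ l0; have := lp q _ _ l0; split; lra.
- by rewrite e1; have := lp p _ _ l1; have := lp q _ _ l1; split; lra.
- by rewrite e2; have := lp p _ _ l2; have := lp q _ _ l2; split; lra.
- by rewrite e3; have := lp p _ _ l3; have := lp q _ _ l3; split; lra.
Qed.

(* The coefficients form the left Perron-Frobenius eigenvector of the tower matrix. *)
Definition mass G := (1 - b ^+ 2) / 2 * incr G 0%N + (1 - 2 * b + b ^+ 2) / 2 * incr G 1%N +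
  (2 * b + b ^+ 2 - 1) / 2 * incr G 2%N + (1 - b ^+ 2) / 2 * incr G 3%N.

Lemma mass_contr G : flip_eq G -> mass (G \o contr) = b ^+ 2 * mass G.
Proof.
move=> /incr_contr; rewrite /mass; set v := incr (G \o contr) => -[-> -> -> ->].
have := b3; have := b4 => h4 h3.
(* Products with [v j] are atoms for [lra], so the power relations are supplied already multiplied
   by each [v j]. *)
have lp (c x y : R) : x = y -> x * c = y * c by move=> ->.
have := lp (v 0%N) _ _ h3; have := lp (v 1%N) _ _ h3; have := lp (v 2%N) _ _ h3.
have := lp (v 3%N) _ _ h3; have := lp (v 0%N) _ _ h4; have := lp (v 1%N) _ _ h4.
have := lp (v 2%N) _ _ h4; have := lp (v 3%N) _ _ h4; lra.
Qed.

(** * Rigidity: monotone solutions of the flip equations are affine *)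

Definition adm (G : R -> R) := flip_eq G /\
  forall x y, 0 <= x -> x <= y -> y <= 1 -> G x <= G y.

Lemma contr01 x : 0 <= x <= 1 -> 0 <= contr x <= 1.
Proof.
have := b_bounds; have := b2_bounds => /andP[? ?] /andP[? ?] /andP[x0 x1].
have : 0 <= b ^+ 2 * x by rewrite mulr_ge0 ?sqr_ge0.
have : b ^+ 2 * x <= b ^+ 2 by rewrite ler_piMr ?sqr_ge0.
by rewrite /contr => ? ?; apply/andP; split; lra.
Qed.

Lemma adm_contr G : adm G -> adm (G \o contr).
Proof.
move=> [fG mG]; split; first exact: flip_eq_contr.
move=> x y x0 xy y1 /=; apply: mG.
- by have /andP[] := contr01 x ltac:(by rewrite x0 (le_trans xy y1)).
- by rewrite /contr lerD2l ler_wpM2l ?sqr_ge0.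
- by have /andP[] := contr01 y ltac:(by rewrite (le_trans x0 xy)).
Qed.

Lemma incr_ge0 G i : adm G -> (i < 4)%N -> 0 <= incr G i.
Proof.
move=> [_ mG] i4; rewrite subr_ge0; apply: mG; last by have /andP[] := cut01 i.+1.
  by have /andP[] := cut01 i.
exact/ltW/cut_lt.
Qed.

(** The coefficients of [mass] exceed 1/20 and the lengths exceed 1/10, whence the constant 200. *)
Lemma mass_ge G i : adm G -> (i < 4)%N -> 0 <= incr G i <= 200 * mass G * len i.
Proof.
move=> aG i4; rewrite incr_ge0 //=.
have v j := incr_ge0 _ j aG; have v0 := v 0%N isT; have v1 := v 1%N isT.
have v2 := v 2%N isT; have v3 := v 3%N isT.
have := b_bounds; have := b2_bounds => /andP[? ?] /andP[? ?].
have y (c x : R) : 1 / 20 <= c -> 0 <= x -> x / 20 <= c * x.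
  by move=> hc x0; have := ler_wpM2r x0 hc; lra.
have y0 := y ((1 - b ^+ 2) / 2) _ ltac:(lra) v0.
have y1 := y ((1 - 2 * b + b ^+ 2) / 2) _ ltac:(lra) v1.
have y2 := y ((2 * b + b ^+ 2 - 1) / 2) _ ltac:(lra) v2.
have y3 := y ((1 - b ^+ 2) / 2) _ ltac:(lra) v3.
have hi : incr G i <= 20 * mass G.
  by rewrite /mass; case: i i4 => [|[|[|[|//]]]] _; lra.
apply: le_trans hi _.
have m0 : 0 <= mass G by rewrite /mass; lra.
rewrite [200 * _]mulrC -mulrA [20 * _]mulrC ler_wpM2l //.
have [/andP[? _] /andP[? _] /andP[? _] /andP[? _]] := len_bounds.
by case: i i4 => [|[|[|[|//]]]] _; lra.
Qed.

(** Starts from the crude bound for the [k]-th renormalization and pinches [k] times on the way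
    back; the factors [b ^+ 2] from [mass_contr] and from the rescaling cancel. *)
Lemma incr_pinch k G : adm G -> exists p q,
  q - p = 200 * mass G * (1 - len 3%N) ^+ k /\
  forall i, (i < 4)%N -> p * len i <= incr G i <= q * len i.
Proof.
have b20 : 0 < b ^+ 2 by exact: exprn_gt0.
elim: k G => [|k IH] G aG.
  exists 0, (200 * mass G); rewrite subr0 expr0 mulr1; split=> // i i4.
  by rewrite mul0r; exact: mass_ge.
have [p [q [pq H]]] := IH _ (adm_contr _ aG).
have [p' [q' [pq' H']]] := doeblin _ _ _ aG.1 H.
exists (p' / b ^+ 2), (q' / b ^+ 2); split.
  rewrite -mulrBl pq' pq mass_contr; last exact: aG.1.
  by rewrite [_ ^+ k.+1]exprS; field; rewrite gt_eqF.
move=> i /H' /andP[h1 h2].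
rewrite mulrAC ler_pdivrMr // mulrAC ler_pdivlMr //.
by rewrite [incr _ _ * _]mulrC h1.
Qed.

(** The mean slope [G 1 - G 0] and the slope over each cell lie in a common interval whose width
    tends to 0. *)
Lemma incr_len G i : adm G -> (i < 4)%N -> incr G i = (G 1 - G 0) * len i.
Proof.
move=> aG i4; apply/eqP; rewrite -subr_eq0 -normr_eq0 eq_le normr_ge0 andbT leNgt.
apply/negP => e0.
have m0 : 0 <= mass G.
  have /andP[h1 h2] := mass_ge _ 0%N aG isT; have := le_trans h1 h2.
  have [/andP[? _] _ _ _] := len_bounds.
  by rewrite pmulr_lge0 ?pmulr_rge0 //; lra.
set e := `| _ | in e0.
(* The added 1 keeps the denominator positive when the mass is 0. *)
have [||k] := exprn_small (1 - len 3%N) (e / (200 * mass G + 1)).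
- by have := b2_bounds; rewrite /len /cut /= => /andP[? ?]; apply/andP; split; lra.
- by rewrite divr_gt0 //; lra.
rewrite ltr_pdivlMr; last by lra.
move=> kz.
have [p [q [pq H]]] := incr_pinch k _ aG.
have z0 : 0 <= (1 - len 3%N) ^+ k.
  by apply: exprn_ge0; have := b2_bounds; rewrite /len /cut /= => /andP[? ?]; lra.
have /andP[h0 h0'] := H 0%N isT; have /andP[h1 h1'] := H 1%N isT.
have /andP[h2 h2'] := H 2%N isT; have /andP[h3 h3'] := H 3%N isT.
have sumG : incr G 0%N + incr G 1%N + incr G 2%N + incr G 3%N = G 1 - G 0.
  by rewrite /incr /cut /=; ring.
have suml c : c * len 0%N + c * len 1%N + c * len 2%N + c * len 3%N = c.
  by rewrite /len /cut /=; ring.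
have hp : p <= G 1 - G 0 by rewrite -sumG -[leLHS]suml; lra.
have hq : G 1 - G 0 <= q by rewrite -sumG -[leRHS]suml; lra.
have /andP[hi hi'] := H i i4.
have /andP[l0 l1] := len01 _ i4.
have : e <= q - p.
  apply: (@le_trans _ _ ((q - p) * len i)); last first.
    by rewrite ler_piMr // subr_ge0; exact: le_trans hp hq.
  have := ler_wpM2r l0 hp; have := ler_wpM2r l0 hq => ? ?.
  by rewrite /e ler_norml; apply/andP; split; lra.
by rewrite pq => he; move: kz he z0; set z := (_ ^+ k); lra.
Qed.

(** The last row of the tower relations holds for increments and lengths alike; the common factor
    [len 2 + len 3] cancels. *)
Lemma incr01_contr G : adm G -> G (contr 1) - G (contr 0) = b ^+ 2 * (G 1 - G 0).
Proof.
move=> aG; have [_ _ _ e] := incr_contr _ aG.1.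
have aG' := adm_contr _ aG; rewrite !incr_len //= in e.
have [_ _ _ l] := len_eigen.
have s0 : len 2%N + len 3%N != 0.
  have [_ _ /andP[? _] /andP[? _]] := len_bounds.
  by rewrite gt_eqF //; lra.
apply: (mulIf s0); have := congr1 (fun z => (G 1 - G 0) * z) l; rewrite /=; lra.
Qed.

Lemma adm_brk G m : adm G -> (m <= 14)%N -> G (brk m) - G 0 = (G 1 - G 0) * brk m.
Proof.
move=> aG; elim: m => [|m IH] m14; first by rewrite /brk /= mulr0 subrr.
have [i4 _ _] := lev_ok _ m14.
have := incr_lev _ _ aG.1 m14; have := brk_diff _ m14; have := IH (ltnW m14).
rewrite incr_len //=; last exact: adm_contr.
rewrite incr01_contr // -/(len _) => h1 h2 h3.
have : (G 1 - G 0) * (brk m.+1 - brk m) = (G 1 - G 0) * (b ^+ 2 * len (base m)).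
  by rewrite h2.
lra.
Qed.

Lemma adm_cut G i : adm G -> (i <= 4)%N -> G (cut i) - G 0 = (G 1 - G 0) * cut i.
Proof.
by move=> aG i4; rewrite -brk_blk // adm_brk //; case: i i4 => [|[|[|[|[|]]]]].
Qed.

(** [G] is exactly affine along the ends of the floors, so its error inside a floor equals, up to
    sign, that of its renormalization, whose total increment is smaller by the factor [b ^+ 2]. *)
Lemma adm_affine_near k G x : adm G -> 0 <= x <= 1 ->
  `|G x - G 0 - (G 1 - G 0) * x| <= (b ^+ 2) ^+ k * (G 1 - G 0).
Proof.
elim: k G x => [|k IH] G x aG x01.
  have /andP[x0 x1] := x01; have mG := aG.2.
  have h0 := mG _ _ (lexx 0) x0 x1; have h1 := mG _ _ x0 x1 (lexx 1).
  have c0 : 0 <= G 1 - G 0 by rewrite subr_ge0 (le_trans h0).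
  have h2 : 0 <= (G 1 - G 0) * x by exact: mulr_ge0.
  have h3 : (G 1 - G 0) * x <= G 1 - G 0 by rewrite ler_piMr.
  by rewrite expr0 mul1r ler_norml; apply/andP; split; lra.
have [|m [/andP[_ m14] xm]] := step_cover brk 0%N 14%N x isT; first by rewrite /brk /=.
have [i4 _ _] := lev_ok _ m14.
have [y [yi xy _]] := lev_inv _ _ m14 xm.
have ci := cut_lt _ i4; have aG' := adm_contr _ aG.
have y01 : 0 <= y <= 1.
  have /andP[y0 y1] := yi.
  have /andP[h0 _] := cut01 (base m); have /andP[_ h1] := cut01 (base m).+1.
  by rewrite (le_trans h0) // (le_trans y1).
have h := IH _ _ aG' y01; rewrite /= incr01_contr // mulrA -exprSr in h.
apply: le_trans h.
have := flip_eq_lev _ _ y (cut (base m)) aG.1 m14 yi.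
rewrite lexx (ltW ci) => /(_ isT); rewrite !travel_pre // subrr mulr0 subr0 addr0.
move: xy; rewrite travel_pre // -signr_odd.
have hb := adm_brk _ m aG (ltnW m14); have hb' := adm_brk _ m.+1 aG m14.
have hc : G (contr (cut (base m))) - G (contr 0) = b ^+ 2 * (G 1 - G 0) * cut (base m).
  by rewrite -incr01_contr //; have := adm_cut _ (base m) aG' (ltnW i4).
case: (odd _) => /= xy; rewrite xy ?expr1 ?expr0 => e;
  have hx := congr1 (fun z => (G 1 - G 0) * z) xy; rewrite /= in hx.
  rewrite (_ : G x - G 0 - (G 1 - G 0) * x =
    - (G (contr y) - G (contr 0) - b ^+ 2 * (G 1 - G 0) * y)) ?normrN //; lra.
rewrite (_ : G x - G 0 - (G 1 - G 0) * x =
  G (contr y) - G (contr 0) - b ^+ 2 * (G 1 - G 0) * y) //; lra.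
Qed.

Lemma adm_affine G x : adm G -> 0 <= x <= 1 -> G x - G 0 = (G 1 - G 0) * x.
Proof.
move=> aG x01; apply/eqP; rewrite -subr_eq0 -normr_eq0 eq_le normr_ge0 andbT leNgt.
apply/negP => e0; set e := `| _ | in e0.
have c0 : 0 <= G 1 - G 0 by rewrite subr_ge0; apply: aG.2.
have [||k] := exprn_small (b ^+ 2) (e / (G 1 - G 0 + 1)).
- by have := b2_bounds => /andP[? ?]; apply/andP; split; lra.
- by rewrite divr_gt0 //; lra.
rewrite ltr_pdivlMr; last by lra.
have z0 : 0 <= (b ^+ 2) ^+ k by rewrite exprn_ge0 // sqr_ge0.
have := adm_affine_near k _ _ aG x01; rewrite -/e.
by move: z0; set z := (_ ^+ k); lra.
Qed.

(** * Invariance of Lebesgue measure *)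

Lemma cell_inj i j x : cut i < x < cut i.+1 -> cut j < x < cut j.+1 -> i = j.
Proof.
move=> xi xj; have i4 := cut_strict _ _ xi; have j4 := cut_strict _ _ xj.
have := b_bounds; have := b2_bounds; move: xi xj.
by case: i i4 => [|[|[|[|//]]]] _; case: j j4 => [|[|[|[|//]]]] _ //;
  rewrite /cut /= => /andP[? ?] /andP[? ?] /andP[? ?] /andP[? ?]; exfalso; lra.
Qed.

Lemma dom01 x : dom x -> 0 < x < 1.
Proof.
move=> [i i4 /andP[h1 h2]].
have /andP[c0 _] := cut01 i; have /andP[_ c1] := cut01 i.+1.
by rewrite (le_lt_trans c0) // (lt_le_trans h2).
Qed.

(** The endpoints of the images of the cells, which from left to right are those of cells 2, 0, 3,
    1. *)
Definition im (k : nat) : R :=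
  nth 1 [:: 0; (1 - b ^+ 2) / 2; (1 + b - b ^+ 2) / 2; (1 + b) / 2] k.

Lemma im_cell k x : (k < 4)%N -> im k < x < im k.+1 ->
  exists2 i, (i < 4)%N & cut i < mirror i - x < cut i.+1.
Proof.
have := b_bounds; have := b2_bounds => /andP[? ?] /andP[? ?].
case: k => [|[|[|[|//]]]] _; rewrite /im /= => /andP[? ?];
  [exists 2%N|exists 0%N|exists 3%N|exists 1%N] => //; rewrite /cut /mirror /=;
  apply/andP; split; lra.
Qed.

Lemma trib_lebesgue :
  IET_invariant 4 1 cut trib (fun A => lebesgue_measure (A `&` `[0, 1])).
Proof.
move=> A mA.
(* [F i] is the part of [A] in the image of cell [i]; its reflection [G i] below is the preimage
   inside the cell. *)
pose F i := `]mirror i - cut i.+1, mirror i - cut i[%classic `&` A.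
have mF i : measurable (F i) by apply: measurableI.
have cellP i z : F i z -> cut i < mirror i - z < cut i.+1.
  by move=> [/= + _]; rewrite in_itv /= => /andP[? ?]; apply/andP; split; lra.
have tF : trivIset setT F.
  move=> i j _ _ [z [/cellP zi /cellP zj]].
  have e : mirror i - z = mirror j - z.
    apply: trib_inj; [exact: dom_cell zi|exact: dom_cell zj|].
    by rewrite (trib_cell _ _ zi) (trib_cell _ _ zj) !subKr.
  by apply: cell_inj zi _; rewrite e.
pose G i := (fun x => mirror i - x) @^-1` F i.
have GP i z : G i z <-> cut i < z < cut i.+1 /\ A (mirror i - z).
  rewrite /G /F /= in_itv /=; split=> -[/andP[? ?] ?]; split=> //;
    by apply/andP; split; lra.
have mG i : measurable (G i).
  have -> : G i = `]cut i, cut i.+1[%classic `&` (fun x => mirror i - x) @^-1` A.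
    by apply/seteqP; split => z /=; rewrite in_itv /= => /GP.
  apply: measurableI => //; rewrite -[X in measurable X]setTI.
  have mf : measurable_fun setT (fun x : R => mirror i - x).
    by apply: measurable_funB; [exact: measurable_cst|exact: measurable_id].
  exact: mf.
have tG : trivIset setT G.
  by move=> i j _ _ [z [/GP[zi _] /GP[zj _]]]; exact: cell_inj zi zj.
have -> : dom `&` trib @^-1` A `&` `[0, 1] = \big[setU/set0]_(i < 4) G i.
  rewrite -(bigcup_mkord 4 _); apply/seteqP; split => z /=.
    move=> [[[i i4 zi] Az] _]; exists i => //; apply/GP.
    by rewrite -(trib_cell _ _ zi).
  move=> [i /= i4 /GP[zi Az]].
  have dz := dom_cell _ _ zi; rewrite (trib_cell _ _ zi); split => //.
  by rewrite in_itv /=; have /andP[/ltW -> /ltW ->] := dom01 _ dz.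
(* The images miss only their finitely many endpoints, a null set. *)
set N := im @` `I_5.
have finN : finite_set N by exact: finite_image.
have cN : countable N by exact: finite_set_countable.
have mN : measurable N by exact: countable_measurable.
have mA1 : measurable (A `&` `[0, 1]) by apply: measurableI.
rewrite [RHS](measureDI lebesgue_measure mA1 mN) [X in (_ + X)%E]countable_lebesgue_measure0; last first.
  by apply: sub_countable cN; apply: subset_card_le => z [].
rewrite adde0.
have -> : A `&` `[0, 1] `\` N = \big[setU/set0]_(i < 4) F i.
  rewrite -(bigcup_mkord 4 _); apply/seteqP; split => z /=.
    move=> [[Az]]; rewrite in_itv /= => z01 Nz.
    have [//|k [/andP[_ k4] /andP[h1 h2]]] := step_cover im 0%N 4%N z isT.
    have [|i i4 zi] := im_cell k z k4.
      rewrite !lt_neqAle h1 h2 !andbT; apply/andP; split; apply/eqP => e; apply: Nz.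
        by exists k => //=; exact: leqW.
      by exists k.+1.
    exists i => //; split => //=; rewrite in_itv /=.
    by move: zi => /andP[? ?]; apply/andP; split; lra.
  move=> [i /= i4 Fz]; have zi := cellP _ _ Fz; have := mirror_bounds _ _ zi.
  rewrite subKr => /andP[z0 z1]; split; first by split; [case: Fz|rewrite in_itv /= !ltW].
  move=> [k /= k5 kz].
  have := b_bounds; have := b2_bounds => /andP[? ?] /andP[? ?].
  move: kz zi; case: k k5 => [|[|[|[|[|//]]]]] _ <-; case: i i4 {Fz} => [|[|[|[|//]]]] _;
    rewrite /im /cut /mirror /= => /andP[? ?]; lra.
have sumE (H : nat -> set R) : trivIset setT H -> (forall i, measurable (H i)) ->
    lebesgue_measure (\big[setU/set0]_(i < 4) (H i : set R)) =
    (\sum_(i < 4) lebesgue_measure (H i))%E.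
  move=> tH mH; apply: measure_bigsetU_ord; first by move=> i; exact: mH.
  by move=> i j _ _ ij; apply: val_inj; exact: tH.
apply: etrans (sumE G tG mG) (etrans _ (esym (sumE F tF mF))).
by apply: eq_bigr => i _; exact: lebesgue_measure_reflect.
Qed.

(** * Uniqueness of the invariant measure *)

Section Uniqueness.
Variable mu : {measure set R -> \bar R}.
Hypothesis mu_fin : (mu setT < +oo)%E.
Hypothesis mu_supp : mu (~` `[0, 1]) = 0%E.
Hypothesis mu_inv : IET_invariant 4 1 cut trib mu.

Lemma atom_trib x : dom x -> mu [set trib x] = mu [set x].
Proof.
move=> dx; rewrite -(mu_inv _ (measurable_set1 _)); congr (mu _).
apply/seteqP; split => [z [dz /= tz]|z ->]; last by [].
exact: trib_inj.
Qed.

Lemma atom_orb p q : orb p q -> mu [set q] = mu [set p].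
Proof.
have fw m x y : fwd dom trib m x y -> mu [set y] = mu [set x].
  by elim=> [//|k u v Du _ ->]; exact: atom_trib.
by case=> m [/fw|/fw].
Qed.

(** Inside ]0, 1[ an infinite orbit carries equal atoms; 0 and 1 have no preimage; any other point
    is outside the support. *)
Lemma atom0 p : mu [set p] = 0%E.
Proof.
have [p01|] := boolP (0 < p < 1).
  by apply: (atom_infinite mu (orb p)) => // [|y]; [exact: orb_infinite|exact: atom_orb].
move=> np; have [p01|] := boolP (0 <= p <= 1).
  rewrite -(mu_inv _ (measurable_set1 _)).
  rewrite (_ : _ `&` _ = set0) ?measure0 //; apply/seteqP; split => // z [[i i4 zi] /=].
  rewrite (trib_cell _ _ zi) => tz; move: np.
  by rewrite -tz (mirror_bounds _ _ zi).
move=> np'; apply: subset_measure0 mu_supp; [exact: measurable_set1| |].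
  by apply: measurableC; exact: measurable_itv.
by move=> z -> /=; rewrite in_itv /=; apply/negP.
Qed.

Definition cdf (x : R) : R := fine (mu `]-oo, x[%classic).

Lemma mu_fin_num A : measurable A -> mu A \is a fin_num.
Proof.
move=> mA; rewrite ge0_fin_numE //; apply: le_lt_trans mu_fin.
by apply: le_measure; rewrite ?inE.
Qed.

Lemma cdfB x y : x <= y -> cdf y - cdf x = fine (mu `]x, y[%classic).
Proof.
rewrite le_eqVlt => /predU1P[->|xy].
  by rewrite subrr set_itv_ge ?measure0 // bnd_simp ltxx.
have E : `]-oo, y[%classic = `]-oo, x[%classic `|` ([set x] `|` `]x, y[%classic).
  apply/seteqP; split => z /=; rewrite !in_itv /=.
    by case: (ltgtP z x) => [|xz|->] => *; [left|right; right|right; left].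
  by case=> [zx|[->//|/andP[]//]]; exact: lt_trans zx xy.
have mx : measurable ([set x] : set R) by exact: measurable_set1.
rewrite /cdf E measureU //; last 2 first.
- exact: measurableU.
- apply/seteqP; split => z //= []; rewrite !in_itv /= => zx [zx'|/andP[xz _]].
    by move: zx; rewrite zx' ltxx.
  by move: (lt_trans zx xz); rewrite ltxx.
rewrite measureU //; last first.
  by apply/seteqP; split => z //= [->]; rewrite in_itv /= ltxx.
rewrite [X in (_ + (X + _))%E]atom0 add0e fineD ?mu_fin_num //.
by rewrite addrAC subrr add0r.
Qed.

Lemma cdf_mono x y : x <= y -> cdf x <= cdf y.
Proof. by move=> xy; rewrite -subr_ge0 cdfB // fine_ge0. Qed.

(** The preimage of the reflected open interval is the original one: injectivity excludes the other
    cells. *)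
Lemma cdf_flip i x : (i < 4)%N -> cut i <= x <= cut i.+1 ->
  cdf (mirror i - cut i) - cdf (mirror i - x) = cdf x - cdf (cut i).
Proof.
move=> i4 /andP[h1 h2]; rewrite !cdfB ?lerD2l ?lerN2 //; congr fine.
rewrite -mu_inv //; congr (mu _); apply/seteqP; split => z /=; rewrite !in_itv /=.
  move=> [dz tz]; have wi : cut i < mirror i - trib z < cut i.+1.
    by move: tz => /andP[? ?]; apply/andP; split; lra.
  have wz : mirror i - trib z = z.
    apply: trib_inj => //; first exact: dom_cell wi.
    by rewrite (trib_cell _ _ wi) subKr.
  by rewrite -wz; move: tz => /andP[? ?]; apply/andP; split; lra.
move=> /andP[z1 z2]; have zi : cut i < z < cut i.+1 by rewrite z1 (lt_le_trans z2).
split; first exact: dom_cell zi.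
by rewrite (trib_cell _ _ zi); apply/andP; split; lra.
Qed.

Lemma cdf_adm : adm cdf.
Proof.
split; last by move=> x y _ xy _; exact: cdf_mono.
by move=> i x y i4 xi yi; have := cdf_flip _ _ i4 xi; have := cdf_flip _ _ i4 yi; lra.
Qed.

Lemma cdf_le0 x : x <= 0 -> cdf x = 0.
Proof.
move=> x0; rewrite /cdf; suff -> : mu `]-oo, x[%classic = 0%E by [].
apply: subset_measure0 mu_supp; [exact: measurable_itv| |].
  by apply: measurableC; exact: measurable_itv.
move=> z /=; rewrite !in_itv /= => zx; apply/negP; rewrite negb_and -ltNge.
by rewrite (lt_le_trans zx x0).
Qed.

Lemma cdf_ge1 x : 1 <= x -> cdf x = cdf 1.
Proof.
move=> x1; apply/eqP; rewrite -subr_eq0 cdfB //.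
suff -> : mu `]1, x[%classic = 0%E by [].
apply: subset_measure0 mu_supp; [exact: measurable_itv| |].
  by apply: measurableC; exact: measurable_itv.
move=> z /=; rewrite !in_itv /= => /andP[z1 _]; apply/negP; rewrite negb_and -!ltNge.
by rewrite z1 orbT.
Qed.

(** Two measures that agree and are finite on the open half-lines, a family stable under
    intersection, agree on Borel sets; on half-lines this is [adm_affine]. *)
Lemma invariant_lebesgue : exists c : R, 0 <= c /\
  forall A : set R, measurable A -> mu A = (c%:E * lebesgue_measure (A `&` `[0%R, 1%R]))%E.
Proof.
have c0 : 0 <= cdf 1 by rewrite -(cdf_le0 0 (lexx 0)); exact: cdf_mono.
exists (cdf 1); split => // A mA.
pose nu : {measure set (measurableTypeR R) -> \bar R} := mscale (NngNum c0) (mrestr lebesgue_measure (measurable_itv `[0 : R, 1])).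
change (mu A = nu A).
(* The identity carries [mu] to the measurable structure on which [nu] lives. *)
pose to_borel (x : R) : measurableTypeR R := x.
have mto : measurable_fun setT to_borel by exact: measurable_id.
change (pushforward mu to_borel A = nu A).
unshelve refine (@measure_unique _ R (measurableTypeR R) (@RGenInftyO.G R)
  (fun k => `]-oo, k%:R[%classic) _ _ _ _ (pushforward mu to_borel) nu _ _ A mA) => //.
- exact: RGenInftyO.measurableE.
- move=> _ _ [x ->] [y ->]; exists (Num.min x y).
  by apply/seteqP; split => z /=; rewrite !in_itv /= lt_min; [case=> -> ->|move/andP].
- by move=> k; exists k%:R.
- apply/seteqP; split => // z _; exists (Num.truncn z).+1 => //=.
  by rewrite in_itv /= truncnS_gt.
- move=> _ [x ->].
  change (mu `]-oo, x[%classic =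
    ((cdf 1)%:E * lebesgue_measure (`]-oo, x[%classic `&` `[0%R, 1%R]))%E).
  have -> : mu `]-oo, x[%classic = (cdf x)%:E by rewrite fineK // mu_fin_num.
  have [x0|x0] := lerP x 0.
    rewrite cdf_le0 //; have -> : `]-oo, x[%classic `&` `[0, 1]%classic = set0.
      apply/seteqP; split => // z [] /=; rewrite !in_itv /= => zx /andP[z0 _].
      by move: (lt_le_trans (le_lt_trans z0 zx) x0); rewrite ltxx.
    by rewrite measure0 mule0.
  have [x1|x1] := lerP x 1.
    have -> : `]-oo, x[%classic `&` `[0, 1]%classic = `[0, x[%classic.
      apply/seteqP; split => z /=; rewrite !in_itv /=; first by move=> [-> /andP[->]].
      by move=> /andP[-> zx]; rewrite zx (ltW (lt_le_trans zx x1)).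
    rewrite lebesgue_measure_itv /= lte_fin x0 -EFinB -EFinM subr0.
    have := adm_affine _ x cdf_adm; rewrite (cdf_le0 0) // !subr0 => -> //.
    by rewrite (ltW x0).
  have -> : `]-oo, x[%classic `&` `[0, 1]%classic = `[0, 1]%classic.
    apply/seteqP; split => z /=; rewrite !in_itv /=; first by case.
    by move=> /andP[-> z1]; rewrite z1 (le_lt_trans z1 x1).
  by rewrite lebesgue_measure_itv /= lte_fin ltr01 -EFinB -EFinM subr0 mulr1 cdf_ge1 // ltW.
- move=> k; change (mu `]-oo, k%:R[%classic < +oo)%E.
  by rewrite -ge0_fin_numE // mu_fin_num.
Qed.

End Uniqueness.

(** * Jumps at the cut points, and the interval exchange *)

Lemma jump i d : (0 < i < 4)%N -> 0 < d -> exists y z,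
  [/\ cut i.-1 < y < cut i, cut i < z < cut i.+1, `|cut i - y| < d, `|cut i - z| < d &
      3 / 20 < `|trib y - trib z| < 17 / 20].
Proof.
move=> i4 d0; set h := Num.min (d / 2) (1 / 50).
have h0 : 0 < h by rewrite lt_min; apply/andP; split; lra.
have hd : h < d by rewrite gt_min; apply/orP; left; lra.
have h50 : h <= 1 / 50 by rewrite ge_min lexx orbT.
have ye : cut i.-1 < cut i - h < cut i.-1.+1 /\ cut i.-1 < cut i - h < cut i.
  have := b_bounds; have := b2_bounds => /andP[? ?] /andP[? ?].
  by case: i i4 => [|[|[|[|//]]]] // _; rewrite /cut /=; split; apply/andP; split; lra.
have ze : cut i < cut i + h < cut i.+1.
  have := b_bounds; have := b2_bounds => /andP[? ?] /andP[? ?].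
  by case: i i4 {ye} => [|[|[|[|//]]]] // _; rewrite /cut /=; apply/andP; split; lra.
exists (cut i - h), (cut i + h); split => //; first exact: ye.2.
- by rewrite subKr gtr0_norm.
- by rewrite opprD addrA subrr sub0r normrN gtr0_norm.
rewrite (trib_cell _ _ ye.1) (trib_cell _ _ ze).
have := b_bounds; have := b2_bounds => /andP[? ?] /andP[? ?].
(* The one-sided limits differ by about 0.65, 0.42 and 0.77; the upper bound 17/20 makes the jump
   visible on the circle too. *)
case: i i4 {ye ze} => [|[|[|[|//]]]] // _; rewrite /mirror /cut /=.
- by rewrite ltr0_norm; [apply/andP; split|]; lra.
- by rewrite gtr0_norm; [apply/andP; split|]; lra.
- by rewrite ltr0_norm; [apply/andP; split|]; lra.
Qed.

Lemma dom_or_cut x : 0 < x < 1 -> dom x \/ exists2 i, (0 < i < 4)%N & x = cut i.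
Proof.
move=> /andP[x0 x1].
have [|m [/andP[_ m4] /andP[h1 h2]]] := step_cover cut 0%N 4%N x isT.
  by rewrite /cut /= !ltW.
have := h1; rewrite le_eqVlt => /predU1P[e|lt1].
  right; exists m => //; rewrite m4 lt0n andbT.
  by apply/eqP => m0; move: x0; rewrite -e m0 /cut /= ltxx.
have := h2; rewrite le_eqVlt => /predU1P[e|lt2]; last first.
  by left; apply: (dom_cell m); rewrite lt1.
right; exists m.+1 => //; rewrite /= ltn_neqAle m4 andbT.
by apply/eqP => m3; move: x1; rewrite e m3 /cut /= ltxx.
Qed.

(** An open subset of [0, 1] contains neither 0 nor 1, and the jumps exclude the interior cut
    points. *)
Lemma trib_no_extension (U : set R) (g : R -> R) : open U -> dom `<` U ->
  U `<=` `[0, 1] -> {within U, continuous g} -> (forall x, dom x -> g x = trib x) -> False.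
Proof.
move=> oU [_ nU] U01 cg gT; apply: nU => x Ux.
have x01 : 0 < x < 1.
  have [e /= e0 eU] : exists2 e : R, 0 < e & ball x e `<=` U.
    by apply/nbhs_ballP; exact: open_nbhs_nbhs.
  have l : U (x - e / 2).
    by apply: eU; rewrite /ball /= opprB addrC subrK gtr0_norm; lra.
  have r : U (x + e / 2).
    by apply: eU; rewrite /ball /= opprD addrA subrr sub0r normrN gtr0_norm; lra.
  move: (U01 _ l) (U01 _ r); rewrite /= !in_itv /= => /andP[? ?] /andP[? ?].
  by apply/andP; split; lra.
have [//|[i i4 xi]] := dom_or_cut _ x01.
exfalso; rewrite continuous_open_subspace // in cg.
have := cg x; rewrite inE => /(_ Ux)/cvgrPdist_lt/(_ (1 / 20)) /=.
have e0 : (0 : R) < 1 / 20 by lra.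
move=> /(_ e0)/nbhs_ballP[d /= d0 dg].
have [y [z [yi zi yd zd /andP[j1 j2]]]] := jump _ _ i4 d0.
have dy : dom y by apply: (dom_cell i.-1); rewrite prednK //; case/andP: i4.
have dz : dom z by exact: dom_cell zi.
have := dg y; rewrite /ball /= xi => /(_ yd); rewrite (gT y dy).
have := dg z; rewrite /ball /= xi => /(_ zd); rewrite (gT z dz).
rewrite !ltr_norml => /andP[? ?] /andP[? ?].
by move: j1; rewrite ltNge ler_norml => /negP; apply;
  apply/andP; split; lra.
Qed.

Lemma trib_IET : is_IET 4 1 cut trib.
Proof.
split.
- by split => //; exact: cut_lt.
- exact: trib_inj.
- by move=> x [i _ xi]; rewrite (trib_cell _ _ xi); case/andP: (mirror_bounds _ _ xi) => /ltW -> /ltW ->.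
- move=> i x y _ xi yi; rewrite (trib_cell _ _ xi) (trib_cell _ _ yi).
  have -> : mirror i - x - (mirror i - y) = - (x - y) by ring.
  by rewrite normrN.
- by move=> [U [g [oU dU U01 cg gT]]]; exact: (trib_no_extension U g oU dU U01 cg gT).
Qed.

Lemma trib_flips : IET_nflips 4 cut trib 4.
Proof.
exists [set: 'I_4]%SET; split; first by rewrite cardsT card_ord.
move=> i; rewrite inE; split=> // _ x y ix xy yi.
have xi : cut i < x < cut i.+1 by rewrite ix (lt_trans xy).
have {}yi : cut i < y < cut i.+1 by rewrite yi (lt_trans ix).
by rewrite (trib_cell _ _ xi) (trib_cell _ _ yi) ltrD2l ltrN2.
Qed.

Lemma half01 : 0 < (1 / 2 : R) < 1.
Proof. by apply/andP; split; lra. Qed.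

Lemma trib_transitive : IET_transitive 4 1 cut trib.
Proof.
exists (1 / 2) => x /=; rewrite in_itv /= => x01 B /nbhs_ballP[e /= e0 eB].
have [q [pq q01 qe]] := orb_dense _ _ _ half01 x01 e0.
by exists q; split => //; apply: eB; rewrite /ball /= distrC.
Qed.

Lemma trib_minimal : IET_minimal 4 1 cut trib.
Proof. by split; [exact: trib_transitive|exact: orb_infinite]. Qed.

Lemma trib_uniquely_ergodic : IET_uniquely_ergodic 4 1 cut trib.
Proof. by split; [exact: trib_lebesgue|move=> mu *; exact: invariant_lebesgue]. Qed.

(** * The circle exchange *)

Definition ccut i := cut i.+1.
Local Notation cdom := (CET_dom 3 ccut).

(** The index shift in [ccut] removes 0 from the cut points; it now lies inside the third arc. *)
Lemma cdomP x : cdom x <-> x = 0 \/ dom x.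
Proof.
split=> [[/andP[x0 x1] nx]|[->|]].
- move: x0; rewrite le_eqVlt => /predU1P[<-|x0]; [by left|right].
  have [||[i /andP[i0 i4] xi]] := dom_or_cut x; [by rewrite x0|by []|].
  by case: i i0 i4 xi => // i _ i4 xi; case: (nx i).
- split; first by rewrite lexx ltr01.
  move=> i i3 /esym; apply/eqP; rewrite gt_eqF //.
  have /andP[? ?] := b_bounds; have /andP[? ?] := b2_bounds.
  by case: i i3 => [|[|[|//]]] _; rewrite /ccut /cut /=; lra.
- move=> dx; have /andP[x0 x1] := dom01 _ dx; split; first by rewrite ltW.
  move=> i i3 xi; case: dx => j j4; rewrite {}xi /ccut.
  have /andP[? ?] := b_bounds; have /andP[? ?] := b2_bounds.
  by case: i i3 => [|[|[|//]]] _; case: j j4 => [|[|[|[|//]]]] _;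
    rewrite /cut /= => /andP[? ?]; lra.
Qed.

Lemma trib_first x : 0 <= x < cut 1%N -> trib x = mirror 0%N - x.
Proof. by case/andP=> _ x1; rewrite /trib x1. Qed.

Lemma trib_0 : trib 0 = mirror 0%N.
Proof.
rewrite trib_first ?subr0 // lexx /=.
by have /andP[? ?] := b_bounds; rewrite /cut /=; lra.
Qed.

(** The value at 0 is the common endpoint of the images of cells 0 and 3, hence in no open image. *)
Lemma trib_inj_0 x : dom x -> trib x <> trib 0.
Proof.
move=> [i i4 xi]; rewrite (trib_cell _ _ xi) trib_0; move: xi.
have /andP[? ?] := b_bounds; have /andP[? ?] := b2_bounds.
by case: i i4 => [|[|[|[|//]]]] _; rewrite /cut /mirror /= => /andP[? ?]; lra.
Qed.

Lemma trib_arc x : CET_arc 3 ccut 2%N x -> trib x = cfrac (mirror 0%N - x).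
Proof.
have /andP[? ?] := b_bounds; have /andP[? ?] := b2_bounds.
rewrite /CET_arc /= => -[x3|x0].
  rewrite (trib_cell 3%N) //; rewrite (cfracD _ 1).
    by rewrite /mirror /=; lra.
  by move: x3; rewrite /ccut /cut /mirror /= => /andP[? ?]; apply/andP; split; lra.
rewrite trib_first //; rewrite (cfracD _ 0) ?addr0 //.
by move: x0; rewrite /ccut /cut /mirror /= => /andP[? ?]; apply/andP; split; lra.
Qed.

Lemma trib_CET : is_CET 3 ccut trib.
Proof.
split.
- split => //.
  + by have /andP[? ?] := b_bounds; rewrite /ccut /cut /=; lra.
  + by have /andP[? ?] := b2_bounds; rewrite /ccut /cut /=; lra.
  + by move=> i i2; exact: (cut_lt i.+1 (leqW i2)).
- move=> x y /cdomP[->|dx] /cdomP[->|dy] // e.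
  + by case: (trib_inj_0 y).
  + by case: (trib_inj_0 x).
  + exact: trib_inj.
- move=> x /cdomP[->|[i _ xi]].
    have /andP[? ?] := b_bounds; have /andP[? ?] := b2_bounds.
    by rewrite trib_0 /mirror /=; apply/andP; split; lra.
  rewrite (trib_cell _ _ xi).
  by have /andP[h1 ->] := mirror_bounds _ _ xi; rewrite ltW.
- have cell j x y : cut j < x < cut j.+1 -> cut j < y < cut j.+1 ->
      cdist (trib x) (trib y) = cdist x y.
    move=> xj yj; rewrite (trib_cell _ _ xj) (trib_cell _ _ yj) /cdist.
    have -> : mirror j - x - (mirror j - y) = - (x - y) by ring.
    by rewrite normrN.
  (* Across 0 the difference [x - y] becomes [1 - (x - y)]; this swaps the two arguments of the
     minimum in [cdist]. *)
  have opp x y : cut 3%N < x < 1 -> 0 <= y < cut 1%N ->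
      cdist (trib x) (trib y) = cdist x y.
    move=> x3 y0; rewrite (trib_cell 3%N) // trib_first // /cdist.
    have -> : mirror 3%N - x - (mirror 0%N - y) = 1 - (x - y) by rewrite /mirror /=; lra.
    have /andP[? ?] := b_bounds; have /andP[? ?] := b2_bounds.
    move: x3 y0; rewrite /cut /= => /andP[? ?] /andP[? ?].
    by rewrite [`|1 - _|]ger0_norm ?[`|x - y|]ger0_norm; first rewrite subKr minC; lra.
  case=> [|[|[|//]]] x y _; rewrite /CET_arc /=; try exact: cell.
  move=> [x3|x0] [y3|y0].
  + exact: (cell 3%N).
  + exact: opp.
  + by rewrite cdist_sym opp // cdist_sym.
  + rewrite !trib_first // /cdist.
    have -> : mirror 0%N - x - (mirror 0%N - y) = - (x - y) by ring.
    by rewrite normrN.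
- move=> [U [g [[_ U01 [cU nU]] g01 cg gT]]]; apply: nU => x Ux.
  split; first exact: U01.
  move=> i i3 xi.
  have [d d0 dg] := cg x Ux (1 / 20) ltac:(lra).
  have i4 : (0 < i.+1 < 4)%N by [].
  have [y [z [yi zi yd zd j]]] := jump _ _ i4 d0.
  have dy : dom y by exact: dom_cell yi.
  have dz : dom z by exact: dom_cell zi.
  have cy : cdom y by apply/cdomP; right.
  have cz : cdom z by apply/cdomP; right.
  have Uy := cU _ cy; have Uz := cU _ cz.
  have ny : cdist x y < d by rewrite xi; exact: le_lt_trans (cdist_le _ _) yd.
  have nz : cdist x z < d by rewrite xi; exact: le_lt_trans (cdist_le _ _) zd.
  apply: (cdist_near _ _ _ (g01 _ Uy) (g01 _ Uz) (g01 _ Ux) (dg _ Uy ny) (dg _ Uz nz)).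
  by rewrite !gT.
Qed.

Lemma trib_cflips : CET_nflips 3 ccut trib 3.
Proof.
exists [set: 'I_3]%SET; split; first by rewrite cardsT card_ord.
move=> i; rewrite inE; split=> // _.
have cell j x : cut j < x < cut j.+1 -> trib x = cfrac (mirror j - x).
  move=> xj; rewrite (trib_cell _ _ xj) (cfracD _ 0) ?addr0 //.
  by have /andP[h1 h2] := mirror_bounds _ _ xj; rewrite ltW.
case: i => [[|[|[|//]]]] ?.
- by exists (mirror 1%N) => x; rewrite /CET_arc /=; exact: cell.
- by exists (mirror 2%N) => x; rewrite /CET_arc /=; exact: cell.
- by exists (mirror 0%N); exact: trib_arc.
Qed.

Lemma trib_ctransitive : CET_transitive 3 ccut trib.
Proof.
exists (1 / 2) => x /andP[x0 x1] e e0.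
have [|q [pq /andP[q0 q1] qe]] := orb_dense _ x _ half01 _ e0; first by rewrite x0 ltW.
exists q; split.
  by apply: orbit_sub pq => z dz; apply/cdomP; right.
by rewrite ltW //; split => //; exact: le_lt_trans (cdist_le _ _) qe.
Qed.

End Tribonacci.

(** * Existence of the parameter, and conclusion *)

Lemma tribonacci_root (R : realType) : exists2 b : R, 0 < b & b + b ^+ 2 + b ^+ 3 = 1.
Proof.
have [||b /andP[b0 _] /rootP] := @poly_ivt R ('X^3 + 'X^2 + 'X - 1%:P) 0 1.
- exact: ler01.
- by rewrite !hornerE /= !expr0n /= !expr1n; apply/andP; split; lra.
rewrite !hornerE => e; exists b; last by lra.
by rewrite lt_neqAle b0 andbT; apply/eqP => z; move: e; rewrite -z !expr0n /=; lra.
Qed.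

Theorem theorem7p1 :
  (exists (l : RR) (a : nat -> RR) (T : RR -> RR),
     [/\ is_IET 4 l a T, IET_nflips 4 a T 4, IET_minimal 4 l a T &
         IET_uniquely_ergodic 4 l a T])
  /\ @calI RR 4 4 !=set0 /\ @calC RR 3 3 !=set0.
Proof.
have [b b_gt0 b_trib] := tribonacci_root RR.
have iet := trib_IET b b_gt0 b_trib; have flips := trib_flips b b_gt0 b_trib.
split; last split.
- exists 1, (cut b), (trib b); split => //; first exact: trib_minimal.
  exact: trib_uniquely_ergodic.
- by exists (1, cut b, trib b); split => //; exact: trib_transitive.
- exists (ccut b, trib b); split; first exact: trib_CET.
  + exact: trib_cflips.
  + exact: trib_ctransitive.
Qed.
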